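(* Let $K$ be an infinite field, let $S=K[x_1,\ldots,x_n]$ be the standard graded polynomial ring with graded maximal ideal $\mathfrak m=(x_1,\ldots,x_n)$, and let $I\subset S$ be a graded ideal. (i) If there exists a $K$-basis $z_1,\ldots,z_n$ of $S_1$ which is a $d$-sequence with respect to the Rees algebra $R(I)$ (viewed as an $S$-module), then $I^k$ is componentwise linear for every $k\geq 1$. (ii) Conversely, if $I^k$ is componentwise linear for every $k\ge 1$, then a generic $K$-basis $z_1,\ldots,z_n$ of $S_1$ is a $d$-sequence with respect to $R(I)$.
   Context: A graded ideal (or finitely generated graded module) $M$ over $S$ is componentwise linear if for every $j$ the submodule $M_{\langle j\rangle}$ generated by the homogeneous component $M_j$ has a linear resolution (i.e. its minimal graded free resolution has all entries of the differential matrices linear forms, equivalently $\mathrm{Tor}_i(M_{\langle j\rangle},K)$ is concentrated in degree $i+j$). The Rees algebra is $R(I)=\bigoplus_{k\ge0}I^kt^k\subset S[t]$. For an $S$-module $M$, a sequence $z_1,\ldots,z_m$ of elements of $S$ generating the ideal $L=(z_1,\ldots,z_m)$ is a $d$-sequence with respect to $M$ if $\big((z_1,\ldots,z_{i-1})M:_M z_i\big)\cap LM=(z_1,\ldots,z_{i-1})M$ for $i=1,\ldots,m$. A property holds for a generic $K$-basis of $S_1$ if there is a nonempty Zariski-open subset $U$ of the space of $n\times n$ matrices over $K$ such that every basis $z_1,\dots,z_n$ whose coefficient matrix with respect to $x_1,\ldots,x_n$ lies in $U$ has the property. *)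

(* Defs.v *)
From HB Require Import structures.
From mathcomp Require Import all_boot all_order all_algebra.
From mathcomp Require Import mpoly.
Set Implicit Arguments. Unset Strict Implicit. Unset Printing Implicit Defensive.
Import GRing.Theory.
Local Open Scope ring_scope.

Definition infinite_type (T : eqType) : Prop := forall s : seq T, exists x, x \notin s.

Section Defs.
Variables (K : fieldType) (n : nat).
Local Notation S := {mpoly K[n]}.

Definition is_ideal (I : S -> Prop) : Prop :=
  [/\ I 0, (forall p q, I p -> I q -> I (p + q)) & (forall c p, I p -> I (c * p))].

Definition hcomp (d : nat) (p : S) : S :=
  \sum_(m <- msupp p | mdeg m == d) p@_m *: 'X_[m].

Definition graded_ideal (I : S -> Prop) : Prop :=
  is_ideal I /\ forall p d, I p -> I (hcomp d p).

Definition gen_ideal (G : S -> Prop) : S -> Prop :=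
  fun p => exists (cs gs : seq S), [/\ size cs = size gs,
    (forall g, g \in gs -> G g) &
    p = \sum_(j < size gs) cs`_j * gs`_j].

Definition prod_ideal (A B : S -> Prop) : S -> Prop :=
  gen_ideal (fun p => exists a b, [/\ A a, B b & p = a * b]).

Fixpoint pow_ideal (I : S -> Prop) (k : nat) : S -> Prop :=
  if k is k'.+1 then prod_ideal (pow_ideal I k') I else (fun _ => True).

Definition rees (I : S -> Prop) : {poly S} -> Prop :=
  fun f => forall k, pow_ideal I k f`_k.

Definition idmod (zs : seq S) (M : {poly S} -> Prop) : {poly S} -> Prop :=
  fun u => exists ms : seq {poly S}, [/\ size ms = size zs,
    (forall m, m \in ms -> M m) &
    u = \sum_(j < size zs) (zs`_j)%:P * ms`_j].

(* z_1, ..., z_n (indexed by 'I_n) is a d-sequence with respect to M: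
   ((z_1..z_{i-1})M :_M z_i) \cap LM = (z_1..z_{i-1})M, L = (z_1..z_n) *)
Definition d_sequence (z : 'I_n -> S) (M : {poly S} -> Prop) : Prop :=
  forall i : 'I_n, forall u : {poly S},
    ((M u /\ idmod [seq z j | j <- [seq j : 'I_n <- enum 'I_n | (nat_of_ord j < nat_of_ord i)%N]] M ((z i)%:P * u))
      /\ idmod [seq z j | j <- enum 'I_n] M u)
    <-> idmod [seq z j | j <- [seq j : 'I_n <- enum 'I_n | (nat_of_ord j < nat_of_ord i)%N]] M u.

Definition lin_forms (C : 'M[K]_n) : 'I_n -> S :=
  fun i => \sum_(j < n) C i j *: 'X_j.

(* N (an ideal) has a j-linear resolution: a graded free resolution
   ... -> S(-j-1)^{b 1} -> S(-j)^{b 0} -> N -> 0 whose generators are forms of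
   degree j and all of whose differential matrices have linear-form entries
   (such a resolution is automatically the minimal one). Row-vector convention. *)
Definition linear_resolution (j : nat) (N : S -> Prop) : Prop :=
  exists (b : nat -> nat) (g : 'cV[S]_(b 0)) (A : forall i, 'M[S]_(b i.+1, b i)),
  [/\ (forall r, g r 0 \is j.-homog),
      (forall p, N p <-> exists v : 'rV[S]_(b 0), p = (v *m g) 0 0),
      (forall i r c, A i r c \is 1.-homog),
      (forall v : 'rV[S]_(b 0), v *m g = 0 <-> exists w, v = w *m A 0) &
      (forall i (v : 'rV[S]_(b i.+1)), v *m A i = 0 <-> exists w, v = w *m A i.+1)].

Definition componentwise_linear (J : S -> Prop) : Prop :=
  forall j, linear_resolution j (gen_ideal (fun p => J p /\ p \is j.-homog)).

Definition zariski_open (U : 'M[K]_n -> Prop) : Prop :=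
  exists fs : seq {mpoly K[n * n]},
    forall C, U C <-> has (fun f => f.@[fun k => mxvec C 0 k] != 0) fs.

Definition generic_basis (P : ('I_n -> S) -> Prop) : Prop :=
  exists U, [/\ zariski_open U, (exists C, U C) &
    forall C, U C -> C \in unitmx -> P (lin_forms C)].
End Defs.

(* Main.v *)
Require Import Defs.
From HB Require Import structures.
From mathcomp Require Import all_boot all_order all_algebra.
From mathcomp Require Import mpoly.
From Stdlib Require Import Classical ClassicalEpsilon.
Set Implicit Arguments. Unset Strict Implicit. Unset Printing Implicit Defensive.
Import GRing.Theory.
Local Open Scope ring_scope.

(* Being a d-sequence on R(I) means being one on every power J = I^k, and no homological
   algebra is needed to compare this with linear resolutions.

   (i) If z is a d-sequence on J, it is one on N = J_<j>.  When N = F / Z is a minimal linear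
   presentation, the d-sequence property gives Z ∩ (z_<i) m F = (z_<i) Z for all i; for i = n
   this says that Z is generated by linear vectors, and for general i it makes z a d-sequence
   on Z.  Iterating produces the linear resolution.

   (ii) Let z_i = sum_j c_ij x_j have indeterminate coefficients.  By McCoy's argument z_i is
   filter regular on every (z_<i)-quotient of an extended module, so that Z ∩ (z_<i) F is
   m-torsion modulo (z_<i) Z for the syzygy modules Z of a linear resolution.  Descending
   induction on i along the whole resolution then shows that, up to nonzero elements of
   K[c], the generic z is a d-sequence on each J_<j>, and hence on I^k.  Finally R(I)[c] is a
   quotient of a polynomial ring in finitely many variables over K[c]; by generic freeness
   (Dickson's lemma and division), inverting one polynomial in c makes R(I)[c]/(z_<i) and
   R(I)[c]/((z_<i) + z_i m) free over K[c] for all i, so the d-sequence property passes to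
   every specialization of c where that polynomial does not vanish, for all k at once. *)

(** * Modules, (z_0, ..., z_(i-1)) N and saturation *)

(** Treating each power separately would give one nonempty open set per k, and over a countable K
    infinitely many of these may have no common point; hence one computation over K[c] for the whole
    Rees algebra. Two quotients enter because specialization at a matrix C meets two obstacles. If
    z_i(C) u = sum z_l(C) w_l, the same combination of the generic forms need not vanish: it is a
    combination of the c_lj - C_lj, and flatness modulo (z_<i) + z_i m turns it into a true relation
    z_i u' in (z_<i), where u' specializes at C to a multiple of u. The generic d-sequence property
    then holds only up to some b in K[c] that depends on u and may vanish at C; freeness modulo
    (z_<i) trades b for a power of one fixed polynomial. The factor m in (z_<i) m F comes from
    minimality: Z lies in m F, so (z_<i) Z can only be compared with the part of Z inside (z_<i) m
    F. *)

Section Spans.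
Variables (R : comRingType) (V : lmodType R) (n : nat).
Implicit Types (N : V -> Prop) (z : 'I_n -> R).

Lemma scaler_swap (a b : R) (v : V) : a *: (b *: v) = b *: (a *: v).
Proof. by rewrite !scalerA mulrC. Qed.

Definition submod N : Prop :=
  [/\ N 0, forall u v, N u -> N v -> N (u + v) & forall a u, N u -> N (a *: u)].

Lemma submod_opp N u : submod N -> N u -> N (- u).
Proof. by case=> _ _ h Nu; rewrite -scaleN1r; apply: h. Qed.

Lemma submod_sub N u v : submod N -> N u -> N v -> N (u - v).
Proof. by move=> sN Nu Nv; case: (sN) => _ h _; apply: h => //; apply: submod_opp. Qed.

Lemma submod_sum N (I : Type) (r : seq I) (P : pred I) (F : I -> V) :
  submod N -> (forall i, P i -> N (F i)) -> N (\sum_(i <- r | P i) F i).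
Proof. by move=> [h0 hD _] hF; apply: (big_ind N) => // i /hF. Qed.

Definition zspan z (i : nat) N (v : V) : Prop :=
  exists w : 'I_n -> V, (forall l, N (w l)) /\ v = \sum_(l < n | (l < i)%N) z l *: w l.

Lemma zspan_submod z i N : submod N -> submod (zspan z i N).
Proof.
move=> sN; case: (sN) => h0 hD hZ; split.
- by exists (fun=> 0); split=> //; rewrite big1 // => l _; rewrite scaler0.
- move=> u v [a [Na ->]] [b [Nb ->]]; exists (fun l => a l + b l); split=> [l|].
    exact: hD.
  by rewrite -big_split; apply: eq_bigr => l _; rewrite scalerDr.
- move=> c u [a [Na ->]]; exists (fun l => c *: a l); split=> [l|]; first exact: hZ.
  by rewrite scaler_sumr; apply: eq_bigr => l _; rewrite !scalerA mulrC.
Qed.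

Lemma zspan_sub z i N N' v : (forall u, N u -> N' u) -> zspan z i N v -> zspan z i N' v.
Proof. by move=> h [w [Nw ->]]; exists w; split=> // l; apply: h. Qed.

Lemma zspan_in z i N v : submod N -> zspan z i N v -> N v.
Proof.
move=> sN [w [Nw ->]]; apply: submod_sum => // l _.
by case: sN => _ _; apply.
Qed.

Lemma zspan_scale z i N N' a v : (forall u, N u -> N' (a *: u)) ->
  zspan z i N v -> zspan z i N' (a *: v).
Proof.
move=> h [w [Nw ->]]; exists (fun l => a *: w l); split=> [l|]; first exact: h.
by rewrite scaler_sumr; apply: eq_bigr => l _; rewrite !scalerA mulrC.
Qed.

Lemma zspan_gen z i N (l : 'I_n) v : submod N -> (l < i)%N -> N v -> zspan z i N (z l *: v).
Proof.
move=> [N0 _ _] li Nv; exists (fun k => if k == l then v else 0); split=> [k|].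
  by case: ifP.
rewrite (bigD1 l) //= eqxx big1 ?addr0 // => k /andP[_ /negbTE ->].
by rewrite scaler0.
Qed.

Lemma zspan_le z i j N v : submod N -> (i <= j)%N -> zspan z i N v -> zspan z j N v.
Proof.
move=> sN ij [w [Nw ->]]; apply: submod_sum; first exact: zspan_submod.
by move=> l li; apply: zspan_gen => //; apply: leq_trans li ij.
Qed.

Lemma zspan0 z N v : zspan z 0 N v -> v = 0.
Proof. by move=> [w [_ ->]]; rewrite big_pred0. Qed.

Lemma zspanS z (i : 'I_n) N v : zspan z i.+1 N v ->
  exists u w, [/\ zspan z i N u, N w & v = u + z i *: w].
Proof.
move=> [w [Nw ->]]; exists (\sum_(l < n | (l < i)%N) z l *: w l), (w i); split=> //.
  by exists w.
rewrite (bigD1 i) //= addrC; congr (_ + _); apply: eq_bigl => l.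
by rewrite ltnS andbC -ltn_neqAle.
Qed.

Lemma zspan_all z i N v : (n <= i)%N -> zspan z i N v <-> zspan z n N v.
Proof.
move=> ni; split=> -[w [Nw ->]]; exists w; split=> //; apply: eq_bigl => l.
  by rewrite (leq_trans (ltn_ord l) ni) ltn_ord.
by rewrite (leq_trans (ltn_ord l) ni) ltn_ord.
Qed.

Definition padd N N' (v : V) : Prop := exists u u', [/\ N u, N' u' & v = u + u'].

Lemma padd_submod N N' : submod N -> submod N' -> submod (padd N N').
Proof.
move=> [a0 aD aZ] [b0 bD bZ]; split.
- by exists 0, 0; split=> //; rewrite addr0.
- move=> _ _ [u [u' [? ? ->]]] [v [v' [? ? ->]]]; exists (u + v), (u' + v').
  by split; [exact: aD|exact: bD|rewrite addrACA].
- move=> c _ [u [u' [? ? ->]]]; exists (c *: u), (c *: u').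
  by split; [exact: aZ|exact: bZ|rewrite scalerDr].
Qed.

Lemma padd_scale N1 N2 M1 M2 (a : R) v : (forall u, N1 u -> M1 (a *: u)) ->
  (forall u, N2 u -> M2 (a *: u)) -> padd N1 N2 v -> padd M1 M2 (a *: v).
Proof.
move=> h1 h2 [u [u' [hu hu' ->]]]; exists (a *: u), (a *: u').
by split; [apply: h1|apply: h2|rewrite scalerDr].
Qed.

Definition mulby (b : R) N (v : V) : Prop := exists2 w, N w & v = b *: w.

Lemma mulby_submod b N : submod N -> submod (mulby b N).
Proof.
move=> [N0 ND NZ]; split=> [|_ _ [u hu ->] [v hv ->]|a _ [u hu ->]].
- by exists 0; rewrite ?scaler0.
- by exists (u + v); [apply: ND|rewrite scalerDr].
- by exists (a *: u); [apply: NZ|rewrite !scalerA mulrC].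
Qed.

Lemma mulby_scale a b N N' v : (forall u, N u -> N' (a *: u)) ->
  mulby b N v -> mulby b N' (a *: v).
Proof. by move=> h [w hw ->]; exists (a *: w); [apply: h|rewrite !scalerA mulrC]. Qed.

Lemma sum_pivot (a : 'I_n -> R) (i : 'I_n) (p : V) (q : 'I_n -> V) :
  \sum_l a l *: (if l == i then p else if (l < i)%N then - q l else 0) =
  a i *: p - \sum_(l < n | (l < i)%N) a l *: q l.
Proof.
rewrite (bigD1 i) //= eqxx; congr (_ + _).
rewrite -sumrN big_mkcond [RHS]big_mkcond; apply: eq_bigr => l _.
case: eqVneq => [->|li] /=; first by rewrite ltnn.
by case: ifP => _; rewrite ?scalerN ?scaler0.
Qed.

(** Compares one relation for two families of coefficients. It is applied to the generic forms and
    their specializations with g l j = (c_lj - C_lj) x_j, which makes the relation a combination of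
    quantities vanishing at C. *)
Lemma sum_pivot_sub (g : 'I_n -> 'I_n -> R) (a b : 'I_n -> R) (i : 'I_n) (p : V)
  (q : 'I_n -> V) : (forall l, \sum_j g l j = a l - b l) ->
  \sum_lj g lj.1 lj.2 *: (if lj.1 == i then p else if (lj.1 < i)%N then - q lj.1 else 0) =
  (a i *: p - \sum_(l < n | (l < i)%N) a l *: q l) -
  (b i *: p - \sum_(l < n | (l < i)%N) b l *: q l).
Proof.
move=> gE; rewrite -!sum_pivot -sumrB.
rewrite -(pair_bigA _ (fun l j => g l j *:
  (if l == i then p else if (l < i)%N then - q l else 0))) /=.
by apply: eq_bigr => l _; rewrite -scaler_suml gE scalerBl.
Qed.

(** For b = z_i, the terms m_j are absorbed into a corrected lift of a u, and only s and the v_j,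
    which lie in (z_<i) N, remain on the right. *)
Lemma scaled_relation (I : finType) (c : I -> R) (v m : I -> V) (a b : R) u s :
  a *: (b *: u - s) = \sum_j c j *: (v j + b *: m j) ->
  b *: (a *: u - \sum_j c j *: m j) = a *: s + \sum_j c j *: v j.
Proof.
move=> h; have -> : b *: (a *: u - \sum_j c j *: m j) =
    a *: s + (a *: (b *: u - s) - b *: \sum_j c j *: m j).
  by rewrite !scalerBr !scalerA [a * b]mulrC [RHS]addrC addrAC subrK.
congr (_ + _); rewrite h scaler_sumr -sumrB; apply: eq_bigr => j _.
by rewrite scalerDr !scalerA [c j * b]mulrC addrK.
Qed.

Lemma pow_lincomb_in N v (x c : 'I_n -> R) t : submod N ->
  (forall j, N (x j ^+ t *: v)) -> exists T, N ((\sum_j c j * x j) ^+ T *: v).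
Proof.
move=> sN xv; case: (sN) => N0 ND NZ.
suff: forall s : seq 'I_n, exists T, N ((\sum_(j <- s) c j * x j) ^+ T *: v) by apply.
elim=> [|j s [T hT]]; first by exists 1%N; rewrite big_nil expr1 scale0r.
(* In every binomial term the partial sum has exponent at least T or the new summand has exponent at
   least t. *)
exists (T + t)%N; rewrite big_cons exprDn scaler_suml; apply: submod_sum => // k _.
rewrite -scalerMnl -scaler_nat; apply: (NZ).
case: (leqP T k) => kT.
  by rewrite -(subnK kT) exprD mulrA -scalerA; apply: NZ.
have tk : (t <= T + t - k)%N by rewrite leq_subRL ?leq_add2r ?(ltnW kT) // (leq_trans (ltnW kT)) ?leq_addr.
by rewrite exprMn -(subnK tk) [x j ^+ _]exprD mulrC !mulrA -scalerA; apply: NZ.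
Qed.
End Spans.

Lemma zspan_lin (R : comRingType) (V W : lmodType R) n (f : {linear V -> W})
  (z : 'I_n -> R) i (N : V -> Prop) (N' : W -> Prop) v :
  (forall u, N u -> N' (f u)) -> zspan z i N v -> zspan z i N' (f v).
Proof.
move=> h [w [Nw ->]]; exists (fun l => f (w l)); split=> [l|]; first exact: h.
by rewrite linear_sum; apply: eq_bigr => l _; rewrite linearZ.
Qed.

Section Saturation.
Variables (R : comRingType) (B : R -> Prop).

Definition mult_closed : Prop := B 1 /\ forall a b, B a -> B b -> B (a * b).

(* The contraction of the localization of M at the multiplicative set B. *)
Definition sat (V : lmodType R) (M : V -> Prop) (v : V) : Prop :=
  exists2 b, B b & M (b *: v).

Hypothesis mB : mult_closed.

Lemma sat_submod (V : lmodType R) (M : V -> Prop) : submod M -> submod (sat M).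
Proof.
move=> [M0 MD MZ]; split.
- by exists 1; [apply: mB.1|rewrite scaler0].
- move=> u v [b b0 Mu] [c c0 Mv]; exists (b * c); first exact: mB.2.
  rewrite scalerDr; apply: MD; last by rewrite -scalerA; apply: MZ.
  by rewrite mulrC -scalerA; apply: MZ.
- move=> a u [b b0 Mu]; exists b => //.
  by rewrite scalerA mulrC -scalerA; apply: MZ.
Qed.

Lemma sat_in (V : lmodType R) (M : V -> Prop) v : M v -> sat M v.
Proof. by exists 1; [apply: mB.1|rewrite scale1r]. Qed.

Lemma sat_sub (V : lmodType R) (M M' : V -> Prop) v :
  (forall u, M u -> M' u) -> sat M v -> sat M' v.
Proof. by move=> h [b b0 /h Mv]; exists b. Qed.
End Saturation.

(** * Gradings *)

Section Gradings.
Variable R : comRingType.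

(** These axioms cover both the degree on S and the x-degree on S[c], where each c_ij has degree 0.
    The bound in [gr_sum] holds for all larger k', so that the entries of a matrix can share one. *)
Record grading (h : nat -> R -> R) (hom : nat -> R -> Prop) : Prop := Grading {
  grD : forall d a b, h d (a + b) = h d a + h d b;
  gr1 : forall d, h d 1 = (d == 0)%:R;
  grM : forall e d x p, hom e x -> h d (x * p) = if (e <= d)%N then x * h (d - e)%N p else 0;
  gr_hom : forall d p, hom d (h d p);
  gr_sum : forall p, exists k, forall k', (k <= k')%N -> p = \sum_(d < k') h d p }.

Variables (h : nat -> R -> R) (hom : nat -> R -> Prop).
Hypothesis gr : grading h hom.

Lemma gr_id d p : hom d p -> h d p = p.
Proof. by move=> hp; rewrite -{1}[p]mulr1 (grM gr _ _ hp) leqnn subnn (gr1 gr) mulr1. Qed.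

Lemma gr_ne d e p : hom e p -> e != d -> h d p = 0.
Proof.
move=> hp ne; rewrite -{1}[p]mulr1 (grM gr _ _ hp); case: leqP => // led.
by rewrite (gr1 gr) subn_eq0 leqNgt ltn_neqAle ne led mulr0.
Qed.

Lemma gr0 d : h d 0 = 0.
Proof. by apply: (addrI (h d 0)); rewrite -(grD gr) !addr0. Qed.

Lemma gr_bigsum d (I : Type) (r : seq I) (P : pred I) F :
  h d (\sum_(i <- r | P i) F i) = \sum_(i <- r | P i) h d (F i).
Proof. by apply: (big_morph (h d) (grD gr d) (gr0 d)). Qed.

Definition hmx d a c (v : 'M[R]_(a, c)) : 'M[R]_(a, c) := map_mx (h d) v.
Definition hommx d a c (v : 'M[R]_(a, c)) : Prop := forall i j, hom d (v i j).

Lemma hmxD d a c (u v : 'M[R]_(a, c)) : hmx d (u + v) = hmx d u + hmx d v.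
Proof. by apply/matrixP => i j; rewrite !mxE (grD gr). Qed.

Lemma hmx0 d a c : hmx d (0 : 'M[R]_(a, c)) = 0.
Proof. by apply/matrixP => i j; rewrite !mxE gr0. Qed.

Lemma hmx_sum d a c (I : Type) (r : seq I) (P : pred I) (F : I -> 'M[R]_(a, c)) :
  hmx d (\sum_(i <- r | P i) F i) = \sum_(i <- r | P i) hmx d (F i).
Proof. by rewrite (big_morph (@hmx d a c) (@hmxD d a c) (hmx0 d a c)). Qed.

Lemma hmx_hom d a c (v : 'M[R]_(a, c)) : hommx d (hmx d v).
Proof. by move=> i j; rewrite mxE; apply: (gr_hom gr). Qed.

Lemma hmx_id d a c (v : 'M[R]_(a, c)) : hommx d v -> hmx d v = v.
Proof. by move=> hv; apply/matrixP => i j; rewrite mxE gr_id. Qed.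

Lemma hmxN d a c (v : 'M[R]_(a, c)) : hmx d (- v) = - hmx d v.
Proof. by apply: (addrI (hmx d v)); rewrite -hmxD !subrr hmx0. Qed.

Lemma hmx_residue d a c (v : 'M[R]_(a, c)) : hmx d (v - hmx d v) = 0.
Proof. by rewrite hmxD hmxN [hmx d (hmx d v)]hmx_id ?subrr //; apply: hmx_hom. Qed.

Lemma hmxZ e d x a c (v : 'M[R]_(a, c)) : hom e x ->
  hmx d (x *: v) = if (e <= d)%N then x *: hmx (d - e) v else 0.
Proof.
move=> hx; apply/matrixP => i j; rewrite mxE mxE (grM gr _ _ hx).
by case: ifP => _; rewrite !mxE.
Qed.

Lemma hmxM e d a b c (v : 'M[R]_(a, b)) (G : 'M[R]_(b, c)) : hommx e G ->
  hmx d (v *m G) = if (e <= d)%N then hmx (d - e) v *m G else 0.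
Proof.
move=> hG; apply/matrixP => i j; rewrite mxE mxE gr_bigsum.
transitivity (\sum_k if (e <= d)%N then G k j * h (d - e) (v i k) else 0).
  by apply: eq_bigr => k _; rewrite mulrC (grM gr _ _ (hG k j)).
case: ifP => _; last by rewrite big1 ?mxE.
by rewrite mxE; apply: eq_bigr => k _; rewrite mxE mulrC.
Qed.

Lemma hmx_partition a c (v : 'M[R]_(a, c)) : exists k, v = \sum_(d < k) hmx d v.
Proof.
have [k hk] : exists k : 'I_a * 'I_c -> nat, forall ij k', (k ij <= k')%N ->
    v ij.1 ij.2 = \sum_(d < k') h d (v ij.1 ij.2).
  apply: (choice (fun ij k => forall k', (k <= k')%N ->
    v ij.1 ij.2 = \sum_(d < k') h d (v ij.1 ij.2))) => ij.
  exact: (gr_sum gr).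
exists (\max_ij k ij); apply/matrixP => i j.
rewrite summxE [LHS](hk (i, j) _ (leq_bigmax (i, j))).
by apply: eq_bigr => d _; rewrite mxE.
Qed.

Section GradedSpan.
Variables (n : nat) (z : 'I_n -> R) (zlin : forall l, hom 1 (z l)) (c : nat).
Implicit Types (N : 'rV[R]_c -> Prop).

Definition graded N : Prop := submod N /\ forall d v, N v -> N (hmx d v).

(** As the z_l are linear, the component of degree d + 1 only involves the degree d components of
    the coefficients; inductions on degree descend through this. *)
Lemma zspan_hmxS i N d v : graded N -> zspan z i N v ->
  zspan z i (fun u => N u /\ hommx d u) (hmx d.+1 v).
Proof.
move=> [sN gN] [w [Nw ->]]; exists (fun l => hmx d (w l)); split=> [l|].
  by split; [apply: gN|apply: hmx_hom].
rewrite hmx_sum; apply: eq_bigr => l _.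
by rewrite (hmxZ _ _ (zlin l)) ltnS subSS subn0.
Qed.

Lemma zspan_hmx0 i N v : zspan z i N v -> hmx 0 v = 0.
Proof.
move=> [w [Nw ->]]; rewrite hmx_sum big1 // => l _.
by rewrite (hmxZ _ _ (zlin l)).
Qed.

Lemma zspan_graded i N : graded N -> graded (zspan z i N).
Proof.
move=> gN; split; first by apply: zspan_submod; case: gN.
case=> [|d] v hv; last by apply: zspan_sub (zspan_hmxS d gN hv) => u [].
rewrite (zspan_hmx0 hv); by have [] := zspan_submod z i gN.1.
Qed.
End GradedSpan.
End Gradings.

Section Homogeneous.
Variables (n : nat) (R : comRingType) (mf : measure n).

Lemma pihomogM e d (x p : {mpoly R[n]}) : x \is e.-homog for mf ->
  pihomog mf d (x * p) = if (e <= d)%N then x * pihomog mf (d - e)%N p else 0.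
Proof.
move=> hx; rewrite {1}(pihomog_partitionE (leqnn (mmeasure mf p))) mulr_sumr raddf_sum /=.
have hom_k k : x * pihomog mf k p \is (e + k).-homog for mf.
  by apply: dhomogM => //; apply: pihomogP.
case: leqP => ed; last first.
  rewrite big1 // => k _; apply: (pihomog_ne0 _ (hom_k k)).
  by rewrite gtn_eqF // (leq_trans ed) // leq_addr.
have [lt|ge] := ltnP (d - e) (mmeasure mf p).
  rewrite (bigD1 (Ordinal lt)) //= big1 ?addr0 => [|k nek].
    by apply: pihomog_dE; rewrite -{2}(subnKC ed); apply: hom_k.
  apply: (pihomog_ne0 _ (hom_k k)); apply: contraNneq nek => ekd.
  by apply/eqP/val_inj; rewrite /= -ekd addKn.
rewrite big1 => [|k _]; last first.
  apply: (pihomog_ne0 _ (hom_k k)); rewrite -(subnKC ed) eqn_add2l.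
  by rewrite ltn_eqF // (leq_trans (ltn_ord k)).
rewrite pihomogE big_seq_cond big1 ?mulr0 // => m /andP[mp /eqP md].
by have := leq_trans (mmeasure_mnm_lt mf mp) ge; rewrite md ltnn.
Qed.

Lemma pihomog_grading :
  grading (fun d (p : {mpoly R[n]}) => pihomog mf d p) (fun d p => p \is d.-homog for mf).
Proof.
split=> [d a b|d|e d x p|d p|p]; first exact: raddfD.
- rewrite -mpolyX0 pihomogX mf0 eq_sym; case: eqP => _ //.
- exact: pihomogM.
- exact: pihomogP.
by exists (mmeasure mf p) => k'; apply: pihomog_partitionE.
Qed.
End Homogeneous.

(** * From a d-sequence to linear resolutions *)

Definition rspan (R : comRingType) b c (G : 'M[R]_(b, c)) (v : 'rV[R]_c) : Prop :=
  exists w : 'rV[R]_b, v = w *m G.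

Lemma rspan_submod (R : comRingType) b c (G : 'M[R]_(b, c)) : submod (rspan G).
Proof.
split=> [|u v [a ->] [b' ->]|a u [w ->]]; first by exists 0; rewrite mul0mx.
  by exists (a + b'); rewrite mulmxDl.
by exists (a *: w); rewrite scalemxAl.
Qed.

Lemma zspan_mulmx (R : comRingType) n (z : 'I_n -> R) i b c (G : 'M[R]_(b, c))
  (N : 'rV[R]_b -> Prop) (N' : 'rV[R]_c -> Prop) v :
  (forall u, N u -> N' (u *m G)) -> zspan z i N v -> zspan z i N' (v *m G).
Proof. by move=> h; apply: (zspan_lin (f := mulmxr G)). Qed.

Lemma ker_submod (R : comRingType) b c (G : 'M[R]_(b, c)) :
  submod (fun v : 'rV[R]_b => v *m G = 0).
Proof.
split=> [|u v hu hv|a u hu]; first by rewrite mul0mx.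
  by rewrite mulmxDl hu hv addr0.
by rewrite -scalemxAl hu scaler0.
Qed.

Lemma true_submod (R : comRingType) (V : lmodType R) : submod (fun _ : V => True).
Proof. by []. Qed.

(* Membership of u in N is implied by u in (z) N. *)
Definition dseq (R : comRingType) (V : lmodType R) n (z : 'I_n -> R) (N : V -> Prop) : Prop :=
  forall (i : 'I_n) u, zspan z n N u -> zspan z i N (z i *: u) -> zspan z i N u.

Lemma dseq_eq (R : comRingType) (V : lmodType R) n (z : 'I_n -> R) (N N' : V -> Prop) :
  (forall u, N u <-> N' u) -> dseq z N -> dseq z N'.
Proof.
move=> NN' dN i u h1 h2; apply: (zspan_sub (N := N)) => [v|]; first by rewrite NN'.
by apply: dN; [apply: zspan_sub h1|apply: zspan_sub h2] => v; rewrite NN'.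
Qed.

Section DsequenceToLinear.
Variables (K : fieldType) (n : nat).
Local Notation S := {mpoly K[n]}.
Local Notation hS := (fun d (p : S) => pihomog mdeg d p).
Local Notation homS := (fun d (p : S) => p \is d.-homog).
Local Notation hmxS := (hmx hS).
Local Notation hommxS := (hommx homS).
Local Notation grS := (pihomog_grading K (mdeg : measure n)).
Local Notation X := (fun j : 'I_n => 'X_j : S).

Lemma homog_pos_split d (p : S) : p \is d.+1.-homog ->
  exists q : 'I_n -> S, (forall j, q j \is d.-homog) /\ p = \sum_j 'X_j * q j.
Proof.
pose P (p : S) := exists q : 'I_n -> S, (forall j, q j \is d.-homog) /\ p = \sum_j 'X_j * q j.
move=> /dhomogP hp; rewrite [p]mpolyE big_seq; apply: (big_ind P).
- by exists (fun=> 0); split=> [j|]; [apply: rpred0|rewrite big1 // => j _; rewrite mulr0].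
- move=> _ _ [q [hq ->]] [q' [hq' ->]]; exists (fun j => q j + q' j); split=> [j|].
    by apply: rpredD.
  by rewrite -big_split; apply: eq_bigr => j _; rewrite mulrDr.
move=> m mp; have md := hp m mp.
have [i mi] : exists i, m i != 0%N.
  apply/existsP; rewrite -[[exists _, _]]negbK; apply/negP => /existsPn m0.
  have : mdeg m = 0%N by rewrite mdegE big1 // => i _; apply/eqP; rewrite -[_ == _]negbK.
  by rewrite md.
have Um : (U_(i) <= m)%MM by rewrite lep1mP.
exists (fun j => if j == i then p@_m *: 'X_[m - U_(i)] else 0); split=> [j|].
  case: ifP => _; last exact: rpred0.
  apply: rpredZ; rewrite dhomogX -(eqn_add2r 1) -{1}(mdeg1 i) -mdegD submK //= md addn1 //.
rewrite (bigD1 i) //= eqxx big1 ?addr0 => [|j /negbTE ->]; last by rewrite mulr0.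
by rewrite -scalerAr -mpolyXD addmC submK.
Qed.

Lemma hommx_pos_X c d (v : 'rV[S]_c) : hommxS d.+1 v -> zspan X n (fun _ => True) v.
Proof.
move=> hv; have [q hq] := choice _ (fun j => homog_pos_split (hv 0 j)).
exists (fun j => \row_i q i j); split=> //.
apply/rowP => i; rewrite (hq i).2 summxE.
by apply: eq_big => [j|j _]; [rewrite ltn_ord|rewrite !mxE].
Qed.

Lemma X_span_pos c (v : 'rV[S]_c) : hmxS 0 v = 0 -> zspan X n (fun _ => True) v.
Proof.
move=> v0; have [k ->] := hmx_partition grS v.
apply: submod_sum => [|[[|d] _] _ /=]; first exact: zspan_submod.
  by rewrite v0; have [] := zspan_submod X n (true_submod 'rV[S]_c).
exact: hommx_pos_X (hmx_hom grS d.+1 v).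
Qed.

Variables (C : 'M[K]_n) (C_unit : C \in unitmx).
Local Notation z := (lin_forms C).

Lemma lin_forms_homog i : z i \is 1.-homog.
Proof. by apply: rpred_sum => j _; apply: rpredZ; rewrite dhomogX /= mdeg1. Qed.

Lemma X_lin_forms j : X j = \sum_k (invmx C j k) *: z k.
Proof.
rewrite /lin_forms; under eq_bigr do rewrite scaler_sumr.
rewrite exchange_big /= (bigD1 j) //= [X in _ + X]big1 => [|l lj].
  under eq_bigr do rewrite scalerA.
  rewrite -scaler_suml addr0.
  by have /matrixP/(_ j j) := mulVmx C_unit; rewrite !mxE eqxx => ->; rewrite scale1r.
under eq_bigr do rewrite scalerA.
rewrite -scaler_suml; have /matrixP/(_ j l) := mulVmx C_unit.
by rewrite !mxE eq_sym (negbTE lj) => ->; rewrite scale0r.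
Qed.

Lemma zspan_X (V : lmodType S) (N : V -> Prop) v : submod N ->
  zspan X n N v -> zspan z n N v.
Proof.
move=> sN [w [Nw ->]]; apply: submod_sum; first exact: zspan_submod.
move=> j _; rewrite X_lin_forms scaler_suml; apply: submod_sum; first exact: zspan_submod.
move=> k _; rewrite -mul_mpolyC -scalerA.
have [_ _ hZ] := zspan_submod z n sN; apply: (hZ); exact: zspan_gen.
Qed.

Local Notation mF := (zspan z n (fun _ => True)).

Lemma true_graded c : graded hS (fun _ : 'rV[S]_c => True).
Proof. by []. Qed.

Lemma hommx_pos_mF c d (v : 'rV[S]_c) : hommxS d.+1 v ->
  zspan z n (fun w => hommxS d w) v.
Proof.
move=> hv; have vF : mF v by apply: zspan_X => //; apply: hommx_pos_X hv.
rewrite -(hmx_id grS hv); apply: zspan_sub (zspan_hmxS grS lin_forms_homog d (true_graded c) vF).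
by move=> u [].
Qed.

Section Componentwise.
Variables (c j : nat) (J N : 'rV[S]_c -> Prop).
Hypotheses (gJ : graded hS J) (gN : graded hS N) (NJ : forall v, N v -> J v).
Hypothesis N_deg_j : forall v, J v -> hommxS j v -> N v.
Hypothesis N_deg_lt : forall d v, (d < j)%N -> N v -> hommxS d v -> v = 0.
Hypothesis N_gen : forall d v, (j < d)%N -> N v -> hommxS d v -> zspan z n N v.
Hypothesis dJ : dseq z J.

(** N stands for J_<j>. Induction on d and, inside it, descending induction on i; for i >= n the
    claim is that N is generated in degree j. For d = j + 1 the coefficients have degree j, where J
    and N agree. *)
Lemma homog_span_descends d i (u : 'rV[S]_c) : (j < d)%N -> N u -> hommxS d u ->
  zspan z i J u -> zspan z i N u.
Proof.
elim: d i u => // d IHd i u jd Nu hu zu.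
have {zu} zu : zspan z i (fun w => J w /\ hommxS d w) u.
  by rewrite -(hmx_id grS hu); apply: (zspan_hmxS grS lin_forms_homog).
move: jd; rewrite ltnS leq_eqVlt => /predU1P[jd|jd].
  by apply: zspan_sub zu => v [Jv]; rewrite -jd; apply: N_deg_j.
elim: {i}(n - i)%N {-2}i (leqnn (n - i)) u Nu hu zu => [i ni u Nu hu _|k IHk i ik u Nu hu zu].
  move: ni; rewrite leqn0 subn_eq0 => ni; apply/(zspan_all _ _ _ ni).
  by apply: N_gen hu; rewrite // ltnS ltnW.
have [ni|ni] := leqP n i; first by apply/(zspan_all _ _ _ ni); apply: N_gen hu; rewrite // ltnS ltnW.
pose o := Ordinal ni.
have zuJ : zspan z i J u by apply: zspan_sub zu => v [].
have zu' : zspan z i.+1 J u by apply: zspan_le zuJ => //; case: gJ.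
have : zspan z i.+1 (fun w => N w /\ hommxS d w) u.
  rewrite -(hmx_id grS hu); apply: (zspan_hmxS grS lin_forms_homog) => //.
  apply: IHk => //; first by rewrite subnS -ltnS prednK // subn_gt0.
  by rewrite -(hmx_id grS hu); apply: (zspan_hmxS grS lin_forms_homog).
move=> /(@zspanS _ _ _ _ o)[v [w [zv [Nw hw] uE]]].
have zvN : zspan z i N v by apply: zspan_sub zv => ? [].
(* z_i w = u - v lies in (z_<i) J, so the d-sequence property of J puts w in (z_<i) J; as w has
   smaller degree than u, the outer induction returns it to (z_<i) N. *)
have zw : zspan z i N w.
  apply: (IHd i) => //; apply: (dJ (i := o)).
    by apply: zspan_sub NJ (N_gen _ _ hw).
  have -> : z o *: w = u - v by rewrite uE addrC addKr.
  by apply: submod_sub zuJ (zspan_sub NJ zvN); apply: zspan_submod; case: gJ.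
have [_ hD hZ] := zspan_submod z i gN.1; rewrite uE; exact/hD/hZ.
Qed.

(** Components of degree above j descend from J to N by the previous lemma; (z) N has no other
    nonzero ones, since N starts in degree j. *)
Lemma dseq_component : dseq z N.
Proof.
move=> i u zu zzu; have zuJ : zspan z i J u.
  by apply: dJ; [apply: zspan_sub NJ zu|apply: zspan_sub NJ zzu].
have Nu := zspan_in gN.1 zu.
have [k ->] := hmx_partition grS u.
apply: submod_sum => [|d _]; first by apply: zspan_submod; case: gN.
have hd := hmx_hom grS d u.
have [jd|dj] := ltnP j d.
  apply: homog_span_descends hd _ => //; first by apply: gN.2.
  by apply: (zspan_graded grS lin_forms_homog i gJ).2.
suff -> : hmxS d u = 0 by have [] := zspan_submod z i gN.1.
move: (nat_of_ord d) dj => [|e] ej; first exact: (zspan_hmx0 grS lin_forms_homog zu).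
have [w [hw ->]] := zspan_hmxS grS lin_forms_homog e gN zu.
by rewrite big1 // => l _; rewrite (N_deg_lt ej (hw l).1 (hw l).2) scaler0.
Qed.
End Componentwise.
End DsequenceToLinear.

(** * K-bases of spaces of homogeneous vectors *)

Section Bases.
Variables (K : fieldType) (n : nat).
Local Notation S := {mpoly K[n]}.
Local Notation homS := (fun d (p : S) => p \is d.-homog).
Local Notation hommxS := (hommx homS).

(** Take a matrix of maximal rank among those with row space inside [W]: adjoining a vector of [W]
    cannot raise its rank, so it already spans [W]. *)
Lemma subspace_matrix m (W : 'rV[K]_m -> Prop) :
  W 0 -> (forall u v, W u -> W v -> W (u + v)) -> (forall a u, W u -> W (a *: u)) ->
  exists r (B : 'M[K]_(r, m)), row_free B /\ forall v, W v <-> (v <= B)%MS.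
Proof.
move=> W0 WD WZ.
pose P r := exists B : 'M[K]_m, \rank B = r /\ forall v : 'rV_m, (v <= B)%MS -> W v.
pose p r : bool := excluded_middle_informative (P r).
have pP r : reflect (P r) (p r) by rewrite /p; case: excluded_middle_informative => ?; constructor.
have ex : exists r, p r.
  by exists 0%N; apply/pP; exists 0; rewrite mxrank0; split=> // v; rewrite submx0 => /eqP ->.
have ub r : p r -> (r <= m)%N by move=> /pP[B [<- _]]; apply: rank_leq_row.
case: (ex_maxnP ex ub) => r /pP[B [rB hB]] rmax.
exists (\rank B), (row_base B); split=> [|v]; first exact: row_base_free.
rewrite eq_row_base; split=> [Wv|]; last exact: hB.
have /rmax : p (\rank (B + v)%MS).
  apply/pP; exists (B + v)%MS; split=> // u /sub_addsmxP[[x y] /= ->].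
  apply: WD; first by apply: hB; apply: submxMl.
  by have /sub_rVP[a ->] := submxMl y v; apply: WZ.
rewrite -rB => le2; have [le3 eqE] := mxrank_leqif_sup (addsmxSl B v).
have : (B + v <= B)%MS by rewrite -eqE eqn_leq le3 le2.
exact: submx_trans (addsmxSr _ _).
Qed.

(** Linear algebra in the finite-dimensional space of vectors of degree at most e. Vectors of degree
    0 are the constant ones, so the last two properties say that the rows of [A] form a K-basis of
    [W]. *)
Lemma homog_basis c e (W : 'rV[S]_c -> Prop) :
  W 0 -> (forall u v, W u -> W v -> W (u + v)) -> (forall a u, W u -> W (a%:MP *: u)) ->
  (forall u, W u -> hommxS e u) ->
  exists b (A : 'M[S]_(b, c)), [/\ hommxS e A, forall i, W (row i A),
    forall u, W u -> exists2 v : 'rV[S]_b, hommxS 0 v & u = v *m A &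
    forall v : 'rV[S]_b, hommxS 0 v -> v *m A = 0 -> v = 0].
Proof.
move=> W0 WD WZ We.
pose I : finType := ('I_c * 'X_{1..n < e.+1})%type.
pose toS (x : 'rV[K]_#|I|) : 'rV[S]_c :=
  \row_i \sum_(m : 'X_{1..n < e.+1}) x 0 (enum_rank (i, m)) *: 'X_[m].
pose ev (k : 'I_#|I|) : ('I_c * 'X_{1..n < e.+1})%type := enum_val k.
pose ofS (u : 'rV[S]_c) : 'rV[K]_#|I| := \row_k (u 0 (ev k).1)@_(ev k).2.
have toSD x y : toS (x + y) = toS x + toS y.
  apply/rowP => i; rewrite !mxE -big_split; apply: eq_bigr => m _.
  by rewrite !mxE scalerDl.
have toSZ a x : toS (a *: x) = a%:MP *: toS x.
  apply/rowP => i; rewrite !mxE mulr_sumr; apply: eq_bigr => m _.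
  by rewrite mxE mul_mpolyC scalerA.
have toS0 : toS 0 = 0.
  by apply/rowP => i; rewrite !mxE big1 // => m _; rewrite mxE scale0r.
have toSK x : ofS (toS x) = x.
  apply/rowP => k; rewrite !mxE raddf_sum /= (bigD1 (ev k).2) //= big1 => [|m ne].
    by rewrite mcoeffZ mcoeffX eqxx mulr1 addr0 -surjective_pairing [ev k]/(enum_val k) enum_valK.
  rewrite mcoeffZ mcoeffX; case: eqP => [/val_inj mE|]; last by rewrite mulr0.
  by rewrite mE eqxx in ne.
have ofSK u : W u -> toS (ofS u) = u.
  move=> /We hu; apply/rowP => i; rewrite mxE.
  have su : (msize (u 0%R i) <= e.+1)%N.
    by apply/bigmax_leqP_seq => m mu _; rewrite (dhomog_mf (hu 0 i) mu).
  rewrite [RHS](mpolywE su); apply: eq_bigr => m _.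
  by rewrite mxE /ev enum_rankK.
have [r [B [Bfree hB]]] : exists r (B : 'M[K]_(r, #|I|)),
    row_free B /\ forall v, W (toS v) <-> (v <= B)%MS.
  apply: (subspace_matrix (W := fun x => W (toS x))) => [|x y|a x].
  - by rewrite toS0.
  - by rewrite toSD; apply: WD.
  - by rewrite toSZ; apply: WZ.
pose A : 'M[S]_(r, c) := \matrix_i toS (row i B).
have WA i : W (row i A) by rewrite rowK; apply/hB/row_sub.
have toSM (y : 'rV[K]_r) : toS (y *m B) = map_mx (@mpolyC n K) y *m A.
  rewrite !mulmx_sum_row (big_morph toS toSD toS0); apply: eq_bigr => i _.
  by rewrite toSZ rowK mxE.
exists r, A; split=> // [i j|u Wu|v hv vA].
- by have := We _ (WA i) 0 j; rewrite mxE.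
- have /submxP[y yB] : (ofS u <= B)%MS by apply/hB; rewrite ofSK.
  exists (map_mx (@mpolyC n K) y); last by rewrite -toSM -yB ofSK.
  move=> i k; rewrite mxE; apply/dhomogP => m; rewrite msuppC.
  by case: ifP => // _; rewrite inE => /eqP ->; rewrite /= mdeg0.
have [y vE] : exists y, v = map_mx (@mpolyC n K) y.
  exists (map_mx (mcoeff 0%MM) v); apply/rowP => i; rewrite !mxE.
  apply/mpolyP => m; rewrite mcoeffC; case: eqP => [->|/eqP m0]; rewrite ?mulr1 // mulr0.
  by apply: dhomog_nemf_coeff (hv 0 i) _; rewrite /= mdeg_eq0.
have : y *m B = 0.
  by rewrite -[LHS]toSK toSM -vE vA -toS0 toSK.
move=> /eqP; rewrite mulmx_free_eq0 // => /eqP y0.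
by rewrite vE y0; apply/rowP => i; rewrite !mxE mpolyC0.
Qed.
End Bases.

(** * Iterated linear syzygies *)

Section Syzygies.
Variables (K : fieldType) (n : nat) (C : 'M[K]_n) (C_unit : C \in unitmx).
Local Notation S := {mpoly K[n]}.
Local Notation z := (lin_forms C).
Local Notation hS := (fun d (p : S) => pihomog mdeg d p).
Local Notation homS := (fun d (p : S) => p \is d.-homog).
Local Notation hmxS := (hmx hS).
Local Notation hommxS := (hommx homS).
Local Notation grS := (pihomog_grading K (mdeg : measure n)).
Local Notation mF := (zspan z n (fun _ => True)).
Local Notation zlin := (lin_forms_homog C).
Hypothesis dS : dseq z (fun _ : 'rV[S]_1 => True).

(** In a free module F, membership in (z_<i) F is tested coordinatewise. The hypothesis [dS] will
    come from I^0 = S. *)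
Lemma dseq_free c : dseq z (fun _ : 'rV[S]_c => True).
Proof.
move=> i u zu [w [_ zzu]].
have hk (k : 'I_c) : exists q : 'I_n -> 'rV[S]_1,
    (u 0 k)%:M = \sum_(l < n | (l < i)%N) z l *: q l.
  have [| |q [_ qE]] := @dS i (u 0 k)%:M; last by exists q.
    have [y [_ ->]] := zu; exists (fun l => (y l 0 k)%:M); split=> //.
    rewrite summxE [LHS]raddf_sum; apply: eq_bigr => l _.
    by rewrite /= mxE -scale_scalar_mx.
  exists (fun l => (w l 0 k)%:M); split=> //.
  have /rowP/(_ k) := zzu; rewrite scale_scalar_mx summxE mxE => ->.
  rewrite [LHS]raddf_sum; apply: eq_bigr => l _.
  by rewrite /= mxE -scale_scalar_mx.
have [q hq] := choice _ hk.
exists (fun l => \row_k q k l 0 0); split=> //; apply/rowP => k.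
have /matrixP/(_ 0 0) := hq k; rewrite mxE eqxx mulr1n => ->.
by rewrite !summxE; apply: eq_bigr => l _; rewrite !mxE.
Qed.

Section Step.
Variables (b c e : nat) (G : 'M[S]_(b, c)).
Hypotheses (G_homog : hommxS e G) (dG : dseq z (rspan G)).
Hypothesis G_indep : forall v : 'rV[S]_b, hommxS 0 v -> v *m G = 0 -> v = 0.
Local Notation Z := (fun v : 'rV[S]_b => v *m G = 0).

Lemma syz_graded : graded hS Z.
Proof.
split=> [|d v vG]; first exact: ker_submod.
have := hmxM grS (d + e)%N v G_homog.
by rewrite vG (hmx0 grS) leq_addl addnK.
Qed.

(** Write u = v + z_i f. The d-sequence property puts f G in (z_<i) times the image of [G]; lifting
    the coefficients yields s in (z_<i) F with f - s a syzygy. Then u - z_i (f - s) is again a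
    syzygy and lies in (z_<i) m F, so i drops by one. *)
Lemma syz_span i u : (i <= n)%N -> zspan z i mF u -> Z u -> zspan z i Z u.
Proof.
have mFs : submod (zspan z n (fun _ : 'rV[S]_b => True)) by apply: zspan_submod.
elim: i u => [|i IHi] u ni zu Zu.
  by rewrite (zspan0 zu); have [] := zspan_submod z 0 (ker_submod G).
pose o := Ordinal ni; have [v [f [zv mf uE]]] := @zspanS _ _ _ _ o _ _ zu.
have [g [hg fGE]] : zspan z i (rspan G) (f *m G).
  apply: (dG (i := o)); first by apply: (zspan_lin (f := mulmxr G)) mf => w _; exists w.
  have -> : z o *: (f *m G) = - (v *m G).
    by apply/eqP; rewrite -addr_eq0 addrC scalemxAl -mulmxDl -uE Zu.
  apply: submod_opp; first exact/zspan_submod/rspan_submod.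
  by apply: (zspan_lin (f := mulmxr G)) zv => w _; exists w.
have [g' hg'] := choice _ hg.
pose s := \sum_(l < n | (l < i)%N) z l *: g' l.
have Zf : Z (f - s).
  rewrite mulmxBl fGE mulmx_suml; apply/eqP; rewrite subr_eq0; apply/eqP.
  by apply: eq_bigr => l _; rewrite hg' scalemxAl.
have uE' : u = (v + z o *: s) + z o *: (f - s).
  by rewrite scalerBr addrACA subrr addr0.
have [_ hD _] := zspan_submod z i.+1 (ker_submod G); rewrite uE'; apply: hD.
  apply: zspan_le (leqnSn i) _; first exact: ker_submod.
  apply: IHi; first exact: ltnW.
    have [_ hD' _] := zspan_submod z i mFs; apply: hD' => //.
    rewrite scaler_sumr; exists (fun l => z o *: g' l); split=> [l|].
      by apply: zspan_gen => //; apply: ltn_ord.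
    by apply: eq_bigr => l _; rewrite !scalerA mulrC.
  have -> : v + z o *: s = u - z o *: (f - s) by rewrite uE' addrK.
  apply: (submod_sub (ker_submod G)) => //.
  by have [_ _ hZ] := ker_submod G; exact: (hZ _ _ Zf).
by apply: zspan_gen => //; exact: ker_submod.
Qed.

(** What is left is to improve u in (z_<i) F to u in (z_<i) m F, by degrees: the components of
    degree 0 and 1 vanish, and in higher degree the coefficients have positive degree. *)
Lemma dseq_syz : dseq z Z.
Proof.
move=> i u zu zzu; apply: syz_span; [exact/ltnW/ltn_ord| |exact: zspan_in (ker_submod G) zu].
have uF : zspan z i (fun _ => True) u.
  by apply: dseq_free; [apply: zspan_sub zu|apply: zspan_sub zzu].
have mFs : submod (zspan z n (fun _ : 'rV[S]_b => True)) by apply: zspan_submod.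
have [k ->] := hmx_partition grS u.
apply: submod_sum => [|[[|[|d]] _] _ /=]; first exact: zspan_submod.
- by rewrite (zspan_hmx0 grS zlin zu); have [] := zspan_submod z i mFs.
(* In degree 1 the coefficients are syzygies of degree 0, and these vanish by minimality. *)
- have [w [hw ->]] := zspan_hmxS grS zlin 0 syz_graded zu.
  rewrite big1 => [|l _]; first by have [] := zspan_submod z i mFs.
  by rewrite (G_indep (hw l).2 (hw l).1) scaler0.
apply: zspan_sub (zspan_hmxS grS zlin d.+1 (true_graded _ _ _) uF) => w [_ hw].
by apply: zspan_sub (hommx_pos_mF C_unit hw).
Qed.

(** [A] is a K-basis of the linear syzygies. It inherits every property required of [G], so the step
    can be repeated indefinitely. *)
Lemma syz_step : exists b' (A : 'M[S]_(b', b)), [/\ hommxS 1 A, dseq z (rspan A),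
  forall v : 'rV[S]_b', hommxS 0 v -> v *m A = 0 -> v = 0 &
  forall v : 'rV[S]_b, v *m G = 0 <-> exists w, v = w *m A].
Proof.
have [|u v|a u||b' [A [hA ZA genA indepA]]] := @homog_basis K n b 1 (fun v => Z v /\ hommxS 1 v).
- by split=> [|i j]; rewrite ?mul0mx // mxE rpred0.
- move=> [Zu hu] [Zv hv]; split; first by rewrite mulmxDl Zu Zv addr0.
  by move=> i j; rewrite mxE rpredD ?hu ?hv.
- move=> [Zu hu]; split; first by rewrite -scalemxAl Zu scaler0.
  by move=> i j; rewrite mxE mul_mpolyC; apply/rpredZ/hu.
- by move=> u [].
have AZ v : rspan A v -> Z v.
  move=> [w ->]; rewrite -mulmxA; suff -> : A *m G = 0 by rewrite mulmx0.
  by apply/row_matrixP => i; rewrite row_mul (ZA i).1 row0.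
(* From degree 2 on, a syzygy lies in (z) m F, hence in (z) Z by [syz_span] with i = n, and its
   coefficients have lower degree. *)
have ZA_deg d v : Z v -> hommxS d v -> rspan A v.
  elim: d v => [|[|d] IHd] v Zv hv.
  - by rewrite (G_indep hv Zv); exists 0; rewrite mul0mx.
  - by have [w _ ->] := genA v (conj Zv hv); exists w.
  apply: (zspan_in (z := z) (i := n)); first exact: rspan_submod.
  apply: (zspan_sub (N := fun w => Z w /\ hommxS d.+1 w)) => [w [Zw hw]|]; first exact: IHd.
  rewrite -(hmx_id grS hv); apply: (zspan_hmxS grS zlin); first exact: syz_graded.
  apply: syz_span => //.
  by apply: zspan_sub (hommx_pos_mF C_unit hv) => w hw; apply: zspan_sub (hommx_pos_mF C_unit hw).
have eqZ v : Z v <-> rspan A v.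
  split=> [Zv|]; last exact: AZ.
  have [k ->] := hmx_partition grS v; apply: submod_sum => [|d _]; first exact: rspan_submod.
  by apply: (ZA_deg d); [apply: syz_graded.2|apply: (hmx_hom grS)].
by exists b', A; split=> //; apply: dseq_eq eqZ dseq_syz.
Qed.
End Step.

Record stage := Stage {
  st_c : nat; st_b : nat; st_e : nat; st_G : 'M[S]_(st_b, st_c);
  st_homog : hommxS st_e st_G;
  st_dseq : dseq z (rspan st_G);
  st_indep : forall v : 'rV[S]_st_b, hommxS 0 v -> v *m st_G = 0 -> v = 0 }.

(** Choosing the size before the matrix makes [st_b (next s)] convertible to [next_b s], so
    successive matrices compose without casts. *)
Definition next_b (s : stage) : nat :=
  proj1_sig (constructive_indefinite_description _
    (syz_step (@st_homog s) (@st_dseq s) (@st_indep s))).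

Lemma next_ex (s : stage) : exists A : 'M[S]_(next_b s, st_b s),
  [/\ hommxS 1 A, dseq z (rspan A),
  forall v : 'rV[S]_(next_b s), hommxS 0 v -> v *m A = 0 -> v = 0 &
  forall v : 'rV[S]_(st_b s), v *m st_G s = 0 <-> exists w, v = w *m A].
Proof. by rewrite /next_b; case: constructive_indefinite_description. Qed.

Definition next_A (s : stage) : 'M[S]_(next_b s, st_b s) :=
  proj1_sig (constructive_indefinite_description _ (next_ex s)).

Lemma next_AP (s : stage) : [/\ hommxS 1 (next_A s), dseq z (rspan (next_A s)),
  forall v : 'rV[S]_(next_b s), hommxS 0 v -> v *m next_A s = 0 -> v = 0 &
  forall v : 'rV[S]_(st_b s), v *m st_G s = 0 <-> exists w, v = w *m next_A s].
Proof. by rewrite /next_A; case: constructive_indefinite_description. Qed.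

Lemma next_homog s : hommxS 1 (next_A s). Proof. by case: (next_AP s). Qed.
Lemma next_dseq s : dseq z (rspan (next_A s)). Proof. by case: (next_AP s). Qed.
Lemma next_indep s (v : 'rV[S]_(next_b s)) : hommxS 0 v -> v *m next_A s = 0 -> v = 0.
Proof. by case: (next_AP s) => _ _ + _; apply. Qed.
Lemma next_exact s (v : 'rV[S]_(st_b s)) : v *m st_G s = 0 <-> exists w, v = w *m next_A s.
Proof. by case: (next_AP s). Qed.

Definition next (s : stage) : stage := Stage (@next_homog s) (@next_dseq s) (@next_indep s).

Lemma stage_resolution (b e : nat) (g : 'cV[S]_b) (N : S -> Prop) :
  hommxS e g -> dseq z (rspan g) ->
  (forall v : 'rV[S]_b, hommxS 0 v -> v *m g = 0 -> v = 0) ->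
  (forall p, N p <-> exists v : 'rV[S]_b, p = (v *m g) 0 0) ->
  linear_resolution e N.
Proof.
move=> hg dg ig gN; pose s i := iter i next (Stage hg dg ig).
exists (fun i => st_b (s i)), g, (fun i => next_A (s i)); split=> // [i r c|v|i v].
- exact: next_homog.
- exact: (next_exact (s := s 0%N)).
- exact: (next_exact (s := s i.+1)).
Qed.
End Syzygies.

Section DsequenceLinear.
Variables (K : fieldType) (n : nat) (C : 'M[K]_n) (C_unit : C \in unitmx).
Local Notation S := {mpoly K[n]}.
Local Notation z := (lin_forms C).
Local Notation hS := (fun d (p : S) => pihomog mdeg d p).
Local Notation homS := (fun d (p : S) => p \is d.-homog).
Local Notation hommxS := (hommx homS).
Local Notation grS := (pihomog_grading K (mdeg : measure n)).

(** An ideal becomes a submodule of the free module of rank one, where the matrix lemmas apply. *)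
Definition ivec (R : comRingType) (J : R -> Prop) (v : 'rV[R]_1) : Prop := J (v 0 0).

(** A K-basis [g] of the forms of degree j in J generates J_<j>, whose d-sequence property comes
    from [dseq_component]; [g] is then the first stage of the resolution. *)
Lemma dseq_componentwise_linear (J : S -> Prop) : dseq z (fun _ : 'rV[S]_1 => True) ->
  graded_ideal J -> dseq z (ivec J) -> componentwise_linear J.
Proof.
move=> dS [[J0 JD JZ] gJ] dJ j.
have gJv : graded hS (ivec J).
  split=> [|d v Jv]; last by rewrite /ivec mxE; apply: gJ.
  split=> [|u v Ju Jv|a u Ju]; rewrite /ivec mxE //; [exact: JD|exact: JZ].
have [| | | |b [g [hg Jg gen ind]]] :=
    @homog_basis K n 1 j (fun v => ivec J v /\ hommxS j v).
- by split=> [|i k]; rewrite ?/ivec mxE ?rpred0.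
- move=> u v [Ju hu] [Jv hv]; split=> [|i k]; first by rewrite /ivec mxE; apply: JD.
  by rewrite mxE rpredD ?hu ?hv.
- move=> a u [Ju hu]; split=> [|i k]; first by rewrite /ivec mxE; apply: JZ.
  by rewrite mxE mul_mpolyC; apply/rpredZ/hu.
- by move=> u [].
have gN : graded hS (rspan g).
  split=> [|d v [w ->]]; first exact: rspan_submod.
  rewrite (hmxM grS _ _ hg); case: ifP => _; first by exists (hmx hS (d - j) w).
  by exists 0; rewrite mul0mx.
have NJ v : rspan g v -> ivec J v.
  move=> [w ->]; rewrite mulmx_sum_row; apply: submod_sum => [|i _]; first exact: gJv.1.
  by have [_ _ hZ] := gJv.1; apply/hZ/(Jg i).1.
have dN : dseq z (rspan g).
  apply: (dseq_component (j := j) gJv gN NJ _ _ _ dJ) => [v Jv hv|d v dj|d v dj].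
  - by have [w _ ->] := gen v (conj Jv hv); exists w.
  - move=> [w ->] hv; rewrite -(hmx_id grS hv) (hmxM grS _ _ hg).
    by rewrite leqNgt dj.
  (* Above degree j the coefficients over [g] can be taken of positive degree, hence in m. *)
  - move=> [w ->] hv; rewrite -(hmx_id grS hv) (hmxM grS _ _ hg) (ltnW dj).
    apply: (zspan_lin (f := mulmxr g) (N := fun _ => True)) => [u _|]; first by exists u.
    rewrite -(subnSK dj); apply: zspan_sub (hommx_pos_mF C_unit (hmx_hom grS _ w)) => //.
apply: (stage_resolution C_unit dS hg dN ind) => p; split.
  move=> [cs [gs [_ Jgs ->]]].
  have : rspan g (\sum_(k < size gs) cs`_k *: (gs`_k)%:M).
    apply: submod_sum => [|k _]; first exact: rspan_submod.
    have [Jk hk] := Jgs _ (mem_nth 0 (ltn_ord k)).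
    have [_ _ hZ] := rspan_submod g; apply: hZ.
    have [|w _ ->] := gen (gs`_k)%:M; last by exists w.
    by split=> [|r t]; rewrite ?/ivec ?ord1 mxE ?eqxx ?mulr1n // ?ord1 mulr1n.
  move=> [w wE]; exists w; rewrite -wE summxE; apply: eq_bigr => k _.
  by rewrite !mxE eqxx mulr1n.
move=> [v ->]; exists [seq v 0 i | i <- enum 'I_b], [seq g i 0 | i <- enum 'I_b].
split; first by rewrite !size_map.
  move=> _ /mapP[i _ ->]; split; last exact: hg.
  by have := (Jg i).1; rewrite /ivec mxE.
rewrite mxE size_map size_enum_ord; apply: eq_bigr => i _.
by rewrite !(nth_map i) -?enumT ?nth_ord_enum ?size_enum_ord.
Qed.
End DsequenceLinear.

(** * The powers of I and the Rees algebra *)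

Section Ideals.
Variables (K : fieldType) (n : nat).
Local Notation S := {mpoly K[n]}.
Implicit Types (I J : S -> Prop).

Lemma ideal_sum J (T : Type) (r : seq T) (P : pred T) F : is_ideal J ->
  (forall t, P t -> J (F t)) -> J (\sum_(t <- r | P t) F t).
Proof. by move=> [J0 JD _] hF; apply: (big_ind J) => // t /hF. Qed.

Lemma gen_ideal_gen (G : S -> Prop) g : G g -> gen_ideal G g.
Proof.
move=> Gg; exists [:: 1], [:: g]; split=> // [h|]; first by rewrite inE => /eqP ->.
by rewrite big_ord1 mul1r.
Qed.

Lemma gen_ideal_is_ideal (G : S -> Prop) : is_ideal (gen_ideal G).
Proof.
split; first by exists [::], [::]; split=> //; rewrite big_ord0.
- move=> _ _ [cs [gs [sz hg ->]]] [cs' [gs' [sz' hg' ->]]].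
  exists (cs ++ cs'), (gs ++ gs'); split=> [|g|]; first by rewrite !size_cat sz sz'.
    by rewrite mem_cat => /orP[/hg|/hg'].
  rewrite size_cat big_split_ord /=; congr (_ + _); apply: eq_bigr => i _.
    by rewrite !nth_cat sz ltn_ord.
  by rewrite !nth_cat sz ltnNge leq_addr addKn.
- move=> c _ [cs [gs [sz hg ->]]]; exists [seq c * a | a <- cs], gs.
  split=> //; first by rewrite size_map.
  rewrite mulr_sumr; apply: eq_bigr => i _.
  by rewrite (nth_map 0) ?sz ?ltn_ord // mulrA.
Qed.

Lemma gen_ideal_min (G J : S -> Prop) p : is_ideal J -> (forall g, G g -> J g) ->
  gen_ideal G p -> J p.
Proof.
move=> iJ GJ [cs [gs [_ hg ->]]]; apply: ideal_sum => // i _.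
case: iJ => _ _ JM; apply/JM/GJ/hg/mem_nth; exact: ltn_ord.
Qed.

Lemma ivec_submod J : is_ideal J -> submod (ivec J).
Proof.
move=> [J0 JD JM]; split=> [|u v Ju Jv|a u Ju]; rewrite /ivec mxE //.
  exact: JD.
exact: JM.
Qed.

Lemma pow_ideal_is_ideal I k : is_ideal I -> is_ideal (pow_ideal I k).
Proof. by case: k => // k _; apply: gen_ideal_is_ideal. Qed.

Lemma pihomog_mul (p q : S) d : exists k,
  pihomog mdeg d (p * q) = \sum_(e < k | (e <= d)%N) pihomog mdeg e p * pihomog mdeg (d - e) q.
Proof.
exists (mmeasure (mdeg : measure n) p).
rewrite {1}(pihomog_partitionE (leqnn (mmeasure (mdeg : measure n) p))).
rewrite mulr_suml raddf_sum [RHS]big_mkcond /=; apply: eq_bigr => e _.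
by rewrite (pihomogM _ _ (pihomogP mdeg e p)).
Qed.

Lemma prod_ideal_graded (A B : S -> Prop) : graded_ideal A -> graded_ideal B ->
  graded_ideal (prod_ideal A B).
Proof.
move=> [iA gA] [iB gB]; split; first exact: gen_ideal_is_ideal.
have iAB : is_ideal (prod_ideal A B) by apply: gen_ideal_is_ideal.
suff h p : prod_ideal A B p -> forall d, prod_ideal A B (pihomog mdeg d p) by move=> p d /h; apply.
apply: (gen_ideal_min (J := fun p => forall d, prod_ideal A B (pihomog mdeg d p))).
  split=> [d|u v hu hv d|c u hu d].
  - by rewrite raddf0; case: iAB.
  - by rewrite raddfD; case: iAB => _ hD _; apply: hD; [apply: hu|apply: hv].
  - have [k ->] := pihomog_mul c u d; apply: ideal_sum => // e _.
    by case: iAB => _ _ hM; apply/hM/hu.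
move=> _ [a [b [Aa Bb ->]]] d; have [k ->] := pihomog_mul a b d.
apply: ideal_sum => // e _; apply: gen_ideal_gen.
by exists (pihomog mdeg e a), (pihomog mdeg (d - e) b); split; [apply: gA|apply: gB|].
Qed.

Lemma pow_ideal_graded I k : graded_ideal I -> graded_ideal (pow_ideal I k).
Proof. by move=> gI; elim: k => //= k IHk; apply: prod_ideal_graded. Qed.

Lemma idmod_zspan (z : 'I_n -> S) (s : seq 'I_n) (M : {poly S} -> Prop) u : uniq s -> M 0 ->
  idmod [seq z j | j <- s] M u <->
  exists w : 'I_n -> {poly S}, (forall l, M (w l)) /\ u = \sum_(l <- s) z l *: w l.
Proof.
move=> us M0; split.
  move=> [ms [sz hms ->]]; exists (fun l => ms`_(index l s)); split=> [l|].
    have [lt|ge] := ltnP (index l s) (size ms); first exact/hms/mem_nth.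
    by rewrite nth_default.
  case: s us sz => [|x s] us sz; first by rewrite big_ord0 big_nil.
  rewrite size_map [RHS](big_nth x) big_mkord; apply: eq_bigr => j _.
  by rewrite index_uniq // (nth_map x) // mul_polyC.
move=> [w [Mw ->]]; exists [seq w j | j <- s]; split; first by rewrite !size_map.
  by move=> _ /mapP[j _ ->].
case: s us => [|x s] us; first by rewrite big_ord0 big_nil.
rewrite size_map [LHS](big_nth x) big_mkord; apply: eq_bigr => j _.
by rewrite !(nth_map x) // mul_polyC.
Qed.

Variables (I : S -> Prop) (iI : is_ideal I).

(** The z_l have t-degree 0, so (z_<i) R(I) is the direct sum of the (z_<i) I^k t^k. *)
Lemma rees_zspan (z : 'I_n -> S) i u : zspan z i (rees I) u <->
  forall k, zspan z i (ivec (pow_ideal I k)) (u`_k)%:M.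
Proof.
split=> [[w [Mw ->]] k|hu].
  exists (fun l => ((w l)`_k)%:M); split=> [l|]; first by rewrite /ivec mxE eqxx; apply: Mw.
  rewrite coef_sum raddf_sum; apply: eq_bigr => l _ /=.
  by rewrite coefZ scale_scalar_mx.
have [w hw] := choice _ hu.
(* The coefficients were chosen for each power of t separately; cutting them off at [size u] makes
   them polynomials in t. *)
exists (fun l => \poly_(k < size u) w k l 0 0); split=> [l k|].
  rewrite coef_poly; case: ifP => _; first exact: (hw k).1.
  by case: (pow_ideal_is_ideal k iI).
apply/polyP => k; rewrite coef_sum.
under eq_bigr do rewrite coefZ coef_poly.
have [lt|ge] := ltnP k (size u); last by rewrite nth_default // big1 // => l _; rewrite mulr0.
have /matrixP/(_ 0 0) := (hw k).2; rewrite mxE eqxx mulr1n => ->.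
by rewrite summxE; apply: eq_bigr => l _; rewrite mxE.
Qed.

Lemma idmod_rees (z : 'I_n -> S) i u :
  idmod [seq z j | j <- [seq j : 'I_n <- enum 'I_n | (nat_of_ord j < i)%N]] (rees I) u <->
  forall k, zspan z i (ivec (pow_ideal I k)) (u`_k)%:M.
Proof.
rewrite -rees_zspan idmod_zspan; [|exact/filter_uniq/enum_uniq|]; last first.
  by move=> k; rewrite coef0; case: (pow_ideal_is_ideal k iI).
by split=> -[w [Mw ->]]; exists w; split=> //; rewrite big_filter big_enum_cond.
Qed.

Lemma idmod_rees_all (z : 'I_n -> S) u :
  idmod [seq z j | j <- enum 'I_n] (rees I) u <->
  forall k, zspan z n (ivec (pow_ideal I k)) (u`_k)%:M.
Proof.
rewrite -idmod_rees; suff -> : [seq j : 'I_n <- enum 'I_n | (j < n)%N] = enum 'I_n by [].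
by apply/all_filterP/allP => j _.
Qed.

(** The direct implication tests the d-sequence property on the monomials u t^k. *)
Lemma d_sequence_rees (z : 'I_n -> S) :
  d_sequence z (rees I) <-> forall k, dseq z (ivec (pow_ideal I k)).
Proof.
split=> [dz k i u zu zzu|dz i u].
  have coefU c l : ((c%:P * 'X^k : {poly S})`_l)%:M = if l == k then c%:M else 0 :> 'M_1.
    by rewrite coefCM coefXn; case: eqP => _; rewrite ?mulr1 // mulr0 raddf0.
  have uE : (u 0 0)%:M = u by apply/matrixP => r s; rewrite !ord1 mxE eqxx.
  have zspan_U j c : zspan z j (ivec (pow_ideal I k)) c%:M -> forall l,
      zspan z j (ivec (pow_ideal I l)) (((c%:P * 'X^k : {poly S})`_l)%:M).
    move=> hc l; rewrite coefU; case: eqP => [-> //|_].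
    by case: (zspan_submod z j (ivec_submod (pow_ideal_is_ideal l iI))).
  have /dz/idmod_rees/(_ k) : (rees I ((u 0 0)%:P * 'X^k) /\
      idmod [seq z j | j <- [seq j : 'I_n <- enum 'I_n | (nat_of_ord j < nat_of_ord i)%N]]
        (rees I) ((z i)%:P * ((u 0 0)%:P * 'X^k)))
      /\ idmod [seq z j | j <- enum 'I_n] (rees I) ((u 0 0)%:P * 'X^k).
    split; last by apply/idmod_rees_all/zspan_U; rewrite uE.
    split=> [l|].
      have := zspan_in (ivec_submod (pow_ideal_is_ideal l iI)) (zspan_U n (u 0 0) _ l).
      by rewrite /ivec mxE eqxx mulr1n; apply; rewrite uE.
    apply/idmod_rees; rewrite mulrA -polyCM; apply: zspan_U.
    by rewrite -scale_scalar_mx uE.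
  by rewrite coefU eqxx uE.
have zc k : (((z i)%:P * u)`_k)%:M = z i *: (u`_k)%:M :> 'M_1.
  by rewrite coefCM scale_scalar_mx.
split=> [[[Mu /idmod_rees zzu] /idmod_rees_all zu]|/idmod_rees zu].
  by apply/idmod_rees => k; apply: dz => //; rewrite -zc.
have sk k := ivec_submod (pow_ideal_is_ideal k iI).
split; last by apply/idmod_rees_all => k; apply: zspan_le (zu k) => //; apply/ltnW/ltn_ord.
split=> [k|]; first by have := zspan_in (sk k) (zu k); rewrite /ivec mxE eqxx.
apply/idmod_rees => k; rewrite zc.
by have [_ _ hZ] := zspan_submod z i (sk k); apply: hZ.
Qed.
End Ideals.

Section FirstHalf.
Variables (K : fieldType) (n : nat) (I : {mpoly K[n]} -> Prop).

Lemma d_sequence_componentwise_linear (C : 'M[K]_n) k : graded_ideal I -> C \in unitmx ->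
  d_sequence (lin_forms C) (rees I) -> componentwise_linear (pow_ideal I k).
Proof.
move=> gI C_unit /(d_sequence_rees gI.1) dI.
(* I^0 is all of S, so k = 0 supplies the d-sequence property on S that the syzygy steps need. *)
by apply: (dseq_componentwise_linear C_unit (dI 0%N)) (dI k); apply: pow_ideal_graded.
Qed.
End FirstHalf.

(** * Modules with generic coefficients adjoined *)

Section CoefficientExtension.
Variables (S : comRingType) (p : nat).
Local Notation T := {mpoly S[p]}.
Local Notation cst := (map_mx (@mpolyC p S)).
Local Notation coefmx m := (map_mx (mcoeff m)).

Lemma mpolyX_ind (P : T -> Prop) : (forall s, P s%:MP) ->
  (forall i f, P f -> P ('X_i * f)) -> (forall f g, P f -> P g -> P (f + g)) ->
  forall f, P f.
Proof.
move=> PC PX PD; elim/mpolyind => [|c m f _ _ Pf]; first by rewrite -mpolyC0.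
apply: PD => //; rewrite -mul_mpolyC mulrC mpolyXE_id.
rewrite -[X in P (X * _)]mulr1; elim/big_rec: _ => [|i q _ Pq]; first by rewrite !mul1r.
by elim: (m i) => [|k IHk]; rewrite ?expr0 ?mul1r // exprS -!mulrA; apply: PX; rewrite !mulrA in IHk *.
Qed.

(* The extension of N to S[c], described through coefficients. *)
Definition ext c (N : 'rV[S]_c -> Prop) (v : 'rV[T]_c) : Prop := forall m, N (coefmx m v).

Lemma coefmxZ c (a : T) (v : 'rV[T]_c) m : coefmx m (a *: v) =
  \sum_(k : 'X_{1..p < (mdeg m).+1, (mdeg m).+1} | m == (k.1 + k.2)%MM) a@_k.1 *: coefmx k.2 v.
Proof.
apply/rowP => i; rewrite !mxE mcoeffM summxE.
by apply: eq_bigr => k _; rewrite !mxE.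
Qed.

Lemma ext_submod c (N : 'rV[S]_c -> Prop) : submod N -> submod (ext N).
Proof.
move=> sN; have [N0 ND NZ] := sN; split=> [m|u v Nu Nv m|a v Nv m].
- suff -> : coefmx m (0 : 'rV[T]_c) = 0 by [].
  by apply/rowP => i; rewrite !mxE mcoeff0.
- suff -> : coefmx m (u + v) = coefmx m u + coefmx m v by apply: ND.
  by apply/rowP => i; rewrite !mxE mcoeffD.
- by rewrite coefmxZ; apply: submod_sum => // k _; apply/NZ/Nv.
Qed.

Lemma coefmx_cst c (v : 'rV[S]_c) m : coefmx m (cst v) = (m == 0%MM)%:R *: v.
Proof. by apply/rowP => i; rewrite !mxE mcoeffC mulrC. Qed.

Lemma ext_cst c (N : 'rV[S]_c -> Prop) v : submod N -> N v -> ext N (cst v).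
Proof. by move=> [_ _ NZ] Nv m; rewrite coefmx_cst; apply: NZ. Qed.

Lemma ext_mono c (N N' : 'rV[S]_c -> Prop) v : (forall u, N u -> N' u) -> ext N v -> ext N' v.
Proof. by move=> h Nv m; apply: h. Qed.

(** S[c] is free over S on the monomials in c, so the extension of N is spanned by the constant
    vectors of N. *)
Lemma ext_ind c (W : 'rV[T]_c -> Prop) v : submod W ->
  (forall m, W (cst (coefmx m v))) -> W v.
Proof.
move=> sW hW; have [_ _ WZ] := sW.
pose k := \max_(i < c) msize (v ord0 i).
have -> : v = \sum_(m : 'X_{1..p < k}) 'X_[m] *: cst (coefmx m v).
  apply/rowP => i; have hi : (msize (v ord0 i) <= k)%N by apply: leq_bigmax.
  rewrite [LHS](mpolywE hi) summxE; apply: eq_bigr => m _.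
  by rewrite !mxE mulrC mul_mpolyC.
by apply: submod_sum => // m _; apply: WZ.
Qed.

Lemma coefmxM b c (v : 'rV[T]_b) (G : 'M[S]_(b, c)) m :
  coefmx m (v *m cst G) = coefmx m v *m G.
Proof.
apply/rowP => j; rewrite !mxE raddf_sum; apply: eq_bigr => i _ /=.
by rewrite !mxE mulrC mcoeffCM mulrC.
Qed.

Lemma cstD c (u v : 'rV[S]_c) : cst (u + v) = cst u + cst v.
Proof. exact: map_mxD. Qed.

Lemma cst0 c : cst (0 : 'rV[S]_c) = 0.
Proof. by rewrite map_mx0. Qed.

Lemma cst_sum c (I : Type) (r : seq I) (Q : pred I) (F : I -> 'rV[S]_c) :
  cst (\sum_(i <- r | Q i) F i) = \sum_(i <- r | Q i) cst (F i).
Proof. by rewrite (big_morph (fun v : 'rV_c => cst v) (@cstD c) (cst0 c)). Qed.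

Lemma cstZ c a (v : 'rV[S]_c) : cst (a *: v) = a%:MP *: cst v.
Proof. by apply/rowP => i; rewrite !mxE mpolyCM. Qed.

Lemma cstM b c (v : 'rV[S]_b) (G : 'M[S]_(b, c)) : cst (v *m G) = cst v *m cst G.
Proof. by rewrite map_mxM. Qed.

Lemma ext_rspan b c (G : 'M[S]_(b, c)) v : ext (rspan G) v <-> rspan (cst G) v.
Proof.
split=> [hv|[w ->] m]; last by exists (coefmx m w); rewrite coefmxM.
apply: ext_ind => [|m]; first exact: rspan_submod.
by have [w ->] := hv m; exists (cst w); rewrite cstM.
Qed.

(** Flatness of S[c] over S, read off coefficient by coefficient. *)
Lemma ext_exact a b c (A : 'M[S]_(a, b)) (G : 'M[S]_(b, c)) :
  (forall v : 'rV[S]_b, v *m G = 0 <-> exists w, v = w *m A) ->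
  forall v : 'rV[T]_b, v *m cst G = 0 <-> rspan (cst A) v.
Proof.
move=> AG v; rewrite -ext_rspan; split=> [vG m|hv].
  by apply/AG; rewrite -coefmxM vG; apply/rowP => i; rewrite !mxE mcoeff0.
apply/rowP => j; apply/mpolyP => m.
have /AG/rowP/(_ j) := hv m; rewrite -coefmxM !mxE => ->.
by rewrite mcoeff0.
Qed.

Section Shift.
Variable k : 'I_p.

(* Division by 'X_k, discarding the terms free of 'X_k. *)
Definition mshift (f : T) : T := \sum_(m : 'X_{1..p < msize f}) f@_(m + U_(k)) *: 'X_[m].

Lemma mcoeff_shift f m : (mshift f)@_m = f@_(m + U_(k)).
Proof.
have [lt|ge] := ltnP (mdeg m) (msize f).
  exact: (mcoeff_mpoly (fun m => f@_(m + U_(k)))).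
rewrite [RHS]memN_msupp_eq0; last first.
  by apply: msize_mdeg_ge; rewrite mdegD (leq_trans ge) ?leq_addr.
rewrite raddf_sum big1 // => m' _ /=; rewrite mcoeffZ mcoeffX.
case: eqP => [mE|]; last by rewrite mulr0.
by have := bmdeg m'; rewrite mE ltnNge ge.
Qed.

Lemma mshiftD f g : mshift (f + g) = mshift f + mshift g.
Proof. by apply/mpolyP => m; rewrite mcoeffD !mcoeff_shift mcoeffD. Qed.

Lemma mshift0 : mshift 0 = 0.
Proof. by apply/mpolyP => m; rewrite mcoeff_shift !mcoeff0. Qed.

Lemma mcoeffXM (i : 'I_p) (f : T) m :
  ('X_i * f)@_m = if (U_(i) <= m)%MM then f@_(m - U_(i)) else 0.
Proof.
rewrite mulrC; case: ifP => Um; first by rewrite -{1}(submK Um) addmC mcoeffMX.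
apply: memN_msupp_eq0; rewrite (perm_mem (msuppMX _ _)).
by apply: contraFN Um => /mapP[m' _ ->]; apply: lem_addr.
Qed.

Lemma mshiftXk f : mshift ('X_k * f) = f.
Proof.
apply/mpolyP => m; rewrite mcoeff_shift mcoeffXM lem_addl.
by rewrite addmK.
Qed.

Lemma mshiftXl i f : i != k -> mshift ('X_i * f) = 'X_i * mshift f.
Proof.
move=> ik; apply/mpolyP => m; rewrite mcoeff_shift !mcoeffXM mcoeff_shift.
have -> : (U_(i) <= m + U_(k))%MM = (U_(i) <= m)%MM.
  by rewrite !lep1mP mnmDE mnm1E [k == i]eq_sym (negbTE ik) addn0.
case: ifP => // Um.
by rewrite [(m + _)%MM]addmC -addmBA // [(_ + (m - _))%MM]addmC.
Qed.

Lemma mshiftC s f : mshift (s%:MP * f) = s%:MP * mshift f.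
Proof. by apply/mpolyP => m; rewrite mcoeff_shift !mcoeffCM mcoeff_shift. Qed.

Lemma mshift_nilp f r : (msize f <= r)%N -> iter r mshift f = 0.
Proof.
move=> fr; apply/mpolyP => m; rewrite mcoeff0.
have -> : (iter r mshift f)@_m = f@_(m + U_(k) *+ r).
  elim: r m {fr} => [|r IHr] m; first by rewrite mulm0n addm0.
  by rewrite iterS mcoeff_shift IHr mulmS addmA.
apply: memN_msupp_eq0; apply: msize_mdeg_ge.
by rewrite mdegD mdegMn mdeg1 mul1n (leq_trans fr) ?leq_addl.
Qed.

Definition shiftmx c (v : 'rV[T]_c) : 'rV[T]_c := map_mx mshift v.

Lemma shiftmxD c (u v : 'rV[T]_c) : shiftmx (u + v) = shiftmx u + shiftmx v.
Proof. by apply/rowP => i; rewrite !mxE mshiftD. Qed.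

Lemma shiftmx0 c : shiftmx (0 : 'rV[T]_c) = 0.
Proof. by apply/rowP => i; rewrite !mxE mshift0. Qed.

Lemma shiftmx_sum c (I : Type) (r : seq I) (P : pred I) (F : I -> 'rV[T]_c) :
  shiftmx (\sum_(i <- r | P i) F i) = \sum_(i <- r | P i) shiftmx (F i).
Proof. by rewrite (big_morph (@shiftmx c) (@shiftmxD c) (@shiftmx0 c)). Qed.

Lemma ext_shift c (N : 'rV[S]_c -> Prop) v : ext N v -> ext N (shiftmx v).
Proof.
move=> hv m; suff -> : coefmx m (shiftmx v) = coefmx (m + U_(k)) v by [].
by apply/rowP => i; rewrite !mxE mcoeff_shift.
Qed.

Lemma shiftmx_nilp c (v : 'rV[T]_c) : exists r, iter r (@shiftmx c) v = 0.
Proof.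
exists (\max_(i < c) msize (v ord0 i)); apply/rowP => i; rewrite mxE.
have -> r : iter r (@shiftmx c) v ord0 i = iter r mshift (v ord0 i).
  by elim: r => //= r IHr; rewrite mxE IHr.
by apply: mshift_nilp; apply: leq_bigmax.
Qed.

(* Multipliers not involving 'X_k. *)
Definition shift_free (a : T) : Prop := forall f, mshift (a * f) = a * mshift f.

Lemma shiftmxZ c a (v : 'rV[T]_c) : shift_free a -> shiftmx (a *: v) = a *: shiftmx v.
Proof. by move=> ha; apply/rowP => i; rewrite !mxE ha. Qed.

Lemma shift_freeC s : shift_free s%:MP. Proof. exact: mshiftC. Qed.

Lemma shift_freeX i : i != k -> shift_free 'X_i.
Proof. by move=> ik f; apply: mshiftXl. Qed.

Lemma shift_freeM a b : shift_free a -> shift_free b -> shift_free (a * b).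
Proof. by move=> ha hb f; rewrite -!mulrA ha hb. Qed.

Lemma shift_free_sum (I : Type) (r : seq I) (P : pred I) F :
  (forall i, P i -> shift_free (F i)) -> shift_free (\sum_(i <- r | P i) F i).
Proof.
move=> hF; apply: big_ind => // [f|a b ha hb f]; first by rewrite !mul0r mshift0.
by rewrite !mulrDl mshiftD ha hb.
Qed.

(* McCoy's argument: if [('X_k * x + y) * f] lies in a module stable under [mshift],
   comparing the coefficients of the powers of 'X_k from the top shows that a power
   of x sends f into it. *)
Lemma shift_mccoy c (M : 'rV[T]_c -> Prop) x y f : submod M ->
  (forall v, M v -> M (shiftmx v)) -> shift_free x -> shift_free y ->
  M (('X_k * x + y) *: f) -> exists t, M (x ^+ t *: f).
Proof.
move=> sM hM hx hy Mf; have [M0 MD MZ] := sM.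
have [r hr] := shiftmx_nilp f.
suff: forall d, (d <= r)%N -> M (x ^+ d *: iter (r - d) (@shiftmx c) f).
  by move=> /(_ r (leqnn r)); rewrite subnn; exists r.
elim=> [|d IHd] dr; first by rewrite subn0 hr scaler0.
set e := (r - d.+1)%N; have re : (r - d)%N = e.+1 by rewrite /e subnSK.
have {IHd} := IHd (ltnW dr); rewrite re iterS => Md.
(* Shifting (X_k x + y) f gives x f + y shift(f), since x and y commute with the shift; thus x times
   an iterate of f is expressed through the next iterate. *)
have itE q : iter q.+1 (@shiftmx c) (('X_k * x + y) *: f) =
    x *: iter q (@shiftmx c) f + y *: shiftmx (iter q (@shiftmx c) f).
  elim: q => [|q IHq] /=; first rewrite scalerDl -scalerA shiftmxD (shiftmxZ _ hy).
    by congr (_ + _); apply/rowP => i; rewrite !mxE mshiftXk.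
  by rewrite iterS in IHq; rewrite IHq shiftmxD !shiftmxZ.
have Mit q : M (iter q (@shiftmx c) (('X_k * x + y) *: f)).
  by elim: q => //= q IHq; apply: hM.
have := MZ (x ^+ d) _ (Mit e.+1); rewrite itE scalerDr scalerA -exprSr => Mxy.
have -> : x ^+ d.+1 *: iter e (@shiftmx c) f = (x ^+ d.+1 *: iter e (@shiftmx c) f +
    x ^+ d *: (y *: shiftmx (iter e (@shiftmx c) f))) -
    y *: (x ^+ d *: shiftmx (iter e (@shiftmx c) f)).
  by rewrite !scalerA [y * _]mulrC addrK.
by apply: submod_sub => //; apply: MZ.
Qed.
End Shift.
End CoefficientExtension.

(** * Generic linear forms *)

HB.lock Definition iota_A (K : fieldType) (n : nat) :
  {mpoly K[n * n]} -> {mpoly {mpoly K[n]}[n * n]} := map_mpoly (@mpolyC n K).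

Section GenericForms.
Variables (K : fieldType) (n : nat).
Local Notation S := {mpoly K[n]}.
Local Notation A := {mpoly K[n * n]}.
Local Notation T := {mpoly S[n * n]}.
Local Notation cst := (map_mx (@mpolyC (n * n) S)).

Local Notation iota_A := (@iota_A K n).

Lemma mcoeff_iota a m : (iota_A a)@_m = (a@_m)%:MP.
Proof. by rewrite unlock mcoeff_map_mpoly. Qed.

Lemma iota_C k : iota_A k%:MP = (k%:MP : S)%:MP.
Proof. by rewrite unlock map_mpolyC. Qed.

Lemma iota_X i : iota_A 'X_i = 'X_i.
Proof. by rewrite unlock map_mpolyX. Qed.

Lemma iotaM a b : iota_A (a * b) = iota_A a * iota_A b. Proof. by rewrite unlock; apply: rmorphM. Qed.
Lemma iotaD a b : iota_A (a + b) = iota_A a + iota_A b. Proof. by rewrite unlock; apply: rmorphD. Qed.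
Lemma iota0 : iota_A 0 = 0. Proof. by rewrite unlock; apply: rmorph0. Qed.
Lemma iota1 : iota_A 1 = 1. Proof. by rewrite unlock; apply: rmorph1. Qed.
Lemma iota_sum (I : Type) (r : seq I) (P : pred I) F :
  iota_A (\sum_(i <- r | P i) F i) = \sum_(i <- r | P i) iota_A (F i).
Proof. by rewrite unlock; apply: rmorph_sum. Qed.
Lemma iota_exp a k : iota_A (a ^+ k) = iota_A a ^+ k. Proof. by rewrite unlock; apply: rmorphXn. Qed.

Definition xT (j : 'I_n) : T := ('X_j : S)%:MP.
Definition cT (i j : 'I_n) : T := 'X_(mxvec_index i j).
Definition zT (i : 'I_n) : T := \sum_j cT i j * xT j.

(** Saturating with respect to [nzT] amounts to working over the field K(c). *)
Definition nzT (r : T) : Prop := exists2 b : A, b != 0 & r = iota_A b.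

Lemma nzT_mult : mult_closed nzT.
Proof.
split; first by exists 1; rewrite ?oner_neq0 // iota1.
by move=> _ _ [a a0 ->] [b b0 ->]; exists (a * b); rewrite ?mulf_neq0 // iotaM.
Qed.

Lemma mxvec_index_inj (i j k l : 'I_n) : mxvec_index i j = mxvec_index k l -> i = k /\ j = l.
Proof. by move=> /cast_ord_inj/enum_rank_inj[-> ->]. Qed.

Section Torsion.
Variables (c : nat) (P P' : 'rV[S]_c -> Prop).
Hypotheses (sP : submod P) (sP' : submod P').

(** c_ij occurs in no z_l with l < i, and extended modules are stable under division by c_ij, so
    this sum is stable as well and McCoy's argument applies to z_i = c_ij x_j + (terms free of
    c_ij). *)
Lemma zT_mccoy (i j : 'I_n) f :
  padd (zspan zT i (ext P)) (ext P') (zT i *: f) ->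
  exists t, padd (zspan zT i (ext P)) (ext P') (xT j ^+ t *: f).
Proof.
have sM : submod (padd (zspan zT i (@ext _ (n * n) _ P)) (ext P')).
  by apply: padd_submod; [apply/zspan_submod/ext_submod|apply: ext_submod].
have row_free l : l != i -> shift_free (mxvec_index i j) (zT l).
  move=> li; apply: shift_free_sum => k _; apply: shift_freeM; last exact: shift_freeC.
  by apply: shift_freeX; apply: contraNneq li => /mxvec_index_inj[->].
have zE : zT i = cT i j * xT j + \sum_(k | k != j) cT i k * xT k.
  by rewrite /zT (bigD1 j).
rewrite zE; apply: shift_mccoy => //.
- move=> _ [u [u' [[w [Pw ->]] Pu' ->]]].
  exists (shiftmx (mxvec_index i j) (\sum_(l < n | (l < i)%N) zT l *: w l)).
  exists (shiftmx (mxvec_index i j) u'); split; [|exact: ext_shift|exact: shiftmxD].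
  exists (fun l => shiftmx (mxvec_index i j) (w l)); split=> [l|]; first exact: ext_shift.
  rewrite shiftmx_sum; apply: eq_bigr => l li; rewrite shiftmxZ //; apply: row_free.
  by rewrite -val_eqE ltn_eqF.
- exact: shift_freeC.
- apply: shift_free_sum => k kj; apply: shift_freeM; last exact: shift_freeC.
  by apply: shift_freeX; apply: contraNneq kj => /mxvec_index_inj[_ ->].
Qed.

(** Write y = v + z_i w with v in (z_<i) P. As z_i w lies in (z_<i) P + P', so does some x_j^t w = u
    + p'; then x_j^t y - z_i p' lies both in P' and in (z_<i) P, which lowers i. *)
Lemma zspan_torsion_x (j : 'I_n) i y : (i <= n)%N -> zspan zT i (ext P) y -> ext P' y ->
  exists t, zspan zT i (ext P') (xT j ^+ t *: y).
Proof.
have seP := @ext_submod S (n * n) c P sP; have seP' := @ext_submod S (n * n) c P' sP'.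
elim: i y => [|i IHi] y ni zy Py.
  exists 0%N; rewrite (zspan0 zy) scaler0.
  by have [] := zspan_submod zT 0 seP'.
pose o := Ordinal ni; have [v [w [zv Pw yE]]] := @zspanS _ _ _ _ o _ _ zy.
have [|t [u [p' [[g [Pg uE]] Pp' twE]]]] := @zT_mccoy o j w.
  have -> : zT o *: w = - v + y by rewrite yE addKr.
  exists (- v), y; split=> //; apply: submod_opp => //; exact: zspan_submod.
have [t' ht'] : exists t', zspan zT i (ext P') (xT j ^+ t' *: (xT j ^+ t *: y - zT o *: p')).
  apply: IHi; first exact: ltnW.
    have -> : xT j ^+ t *: y - zT o *: p' = xT j ^+ t *: v + zT o *: u.
      rewrite yE scalerDr -addrA; congr (_ + _).
      by rewrite scalerA mulrC -scalerA twE -scalerBr addrK.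
    have [_ hD hZ] := zspan_submod zT i seP; apply: (hD); first exact: hZ.
    apply: hZ; exact: (ex_intro _ g (conj Pg uE)).
  by apply: (submod_sub seP'); have [_ _ hZ] := seP'; exact: hZ.
exists (t' + t)%N; rewrite exprD -scalerA.
have -> : xT j ^+ t *: y = (xT j ^+ t *: y - zT o *: p') + zT o *: p' by rewrite subrK.
rewrite scalerDr; have [_ hD hZ] := zspan_submod zT i.+1 seP'; apply: hD.
  by apply: zspan_le ht'.
by apply: hZ; apply: zspan_gen => //=.
Qed.

Lemma zspan_torsion (l : 'I_n) i y : (i <= n)%N -> zspan zT i (ext P) y -> ext P' y ->
  exists t, zspan zT i (ext P') (zT l ^+ t *: y).
Proof.
move=> ni zy Py.
have [t ht] := choice _ (fun j => zspan_torsion_x j ni zy Py).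
have sM : submod (zspan zT i (@ext S (n * n) _ P')) by apply/zspan_submod/ext_submod.
have [|t' ht'] := @pow_lincomb_in T _ n (zspan zT i (ext P')) y xT (cT l) (\max_j t j) sM.
  move=> j; have [_ _ hZ] := sM; have tj : (t j <= \max_j t j)%N by apply: leq_bigmax.
  by rewrite -(subnK tj) exprD -scalerA; apply: hZ.
by exists t'.
Qed.
End Torsion.
End GenericForms.

HB.lock Definition hT (K : fieldType) (n : nat) (d : nat)
  (f : {mpoly {mpoly K[n]}[n * n]}) : {mpoly {mpoly K[n]}[n * n]} :=
  map_mpoly (pihomog mdeg d) f.

(* The substitution of [h j] for [x_j], fixing the coefficients [c_ij]. *)
HB.lock Definition subT (K : fieldType) (n : nat) (h : 'I_n -> {mpoly {mpoly K[n]}[n * n]}) :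
  {mpoly {mpoly K[n]}[n * n]} -> {mpoly {mpoly K[n]}[n * n]} :=
  mmap (mmap (@mpolyC (n * n) {mpoly K[n]} \o @mpolyC n K) h) (fun i => 'X_i).

(** * Regularity of the generic linear forms on free modules *)

Section GenericRegular.
Variables (K : fieldType) (n : nat).
Local Notation S := {mpoly K[n]}.
Local Notation A := {mpoly K[n * n]}.
Local Notation T := {mpoly S[n * n]}.
Local Notation xT := (@xT K n).
Local Notation zT := (@zT K n).
Local Notation iota_A := (@iota_A K n).
Local Notation cst := (map_mx (@mpolyC (n * n) S)).

Local Notation nzT := (@nzT K n).
Local Notation hT := (@hT K n).
Local Notation subT := (@subT K n).
Definition homT d (f : T) : Prop := forall m, f@_m \is d.-homog.

Lemma mcoeff_hT d f m : (hT d f)@_m = pihomog mdeg d f@_m.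
Proof. by rewrite unlock mcoeff_map_mpoly. Qed.

Lemma hTC d (s : S) : hT d s%:MP = (pihomog mdeg d s)%:MP.
Proof. by rewrite unlock map_mpolyC. Qed.

Lemma hTD d (f g : T) : hT d (f + g) = hT d f + hT d g.
Proof. by rewrite unlock; apply: raddfD. Qed.

Lemma hT_grading : grading hT homT.
Proof.
split=> [d a b|d|e d x p hx|d p m|p].
- exact: hTD.
- have e1 : (1 : T) = (1 : S)%:MP by rewrite mpolyC1.
  rewrite e1 hTC (gr1 (pihomog_grading K (mdeg : measure n))).
  exact: mpolyC_nat.
- apply/mpolyP => m; rewrite mcoeff_hT mcoeffM raddf_sum /=.
  transitivity (\sum_(k : 'X_{1..(n * n) < (mdeg m).+1, (mdeg m).+1} | m == (k.1 + k.2)%MM)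
      (if (e <= d)%N then x@_k.1 * pihomog mdeg (d - e) p@_k.2 else 0)).
    by apply: eq_bigr => k _; rewrite (pihomogM _ _ (hx _)).
  case: ifP => _; last by rewrite big1 ?mcoeff0.
  by rewrite mcoeffM; apply: eq_bigr => k _; rewrite mcoeff_hT.
- by rewrite mcoeff_hT; apply: pihomogP.
exists (\max_(m <- msupp p) mmeasure (mdeg : measure n) p@_m) => k hk.
apply/mpolyP => m; rewrite raddf_sum /=.
under eq_bigr do rewrite mcoeff_hT.
have [mp|mp] := boolP (m \in msupp p).
  apply: pihomog_partitionE; apply: leq_trans hk.
  by rewrite (bigD1_seq m) //= leq_maxl.
by rewrite (memN_msupp_eq0 mp) big1 // => d _; rewrite raddf0.
Qed.

Lemma mpolyC_homT d (s : S) : s \is d.-homog -> homT d s%:MP.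
Proof. by move=> hs m; rewrite mcoeffC; case: eqP; rewrite ?mulr1 ?mulr0 ?rpred0. Qed.

Lemma cst_homT d a c (G : 'M[S]_(a, c)) : hommx (fun d p => p \is d.-homog) d G ->
  hommx homT d (cst G).
Proof. by move=> hG i j; rewrite mxE; apply: mpolyC_homT. Qed.

Lemma mpolyX_homT (i : 'I_(n * n)) : homT 0 ('X_i : T).
Proof.
by move=> m; rewrite mcoeffX; case: eqP => _ /=; [apply: dhomog1|apply: rpred0].
Qed.

Lemma homT_M d e x y : homT d x -> homT e y -> homT (d + e) (x * y).
Proof.
by move=> hx hy m; rewrite mcoeffM; apply: rpred_sum => k _; apply: dhomogM.
Qed.

Lemma homT_sum d (I : Type) (r : seq I) (P : pred I) F :
  (forall i, P i -> homT d (F i)) -> homT d (\sum_(i <- r | P i) F i).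
Proof.
by move=> hF m; rewrite raddf_sum; apply: rpred_sum => i Pi; apply: hF.
Qed.

Lemma xT_hom j : homT 1 (xT j).
Proof. by apply: mpolyC_homT; rewrite dhomogX /= mdeg1. Qed.

Lemma zT_hom i : homT 1 (zT i).
Proof.
by apply: homT_sum => j _; apply: (@homT_M 0 1); [apply: mpolyX_homT|apply: xT_hom].
Qed.

Lemma iota_A_hom b : homT 0 (iota_A b).
Proof.
move=> m; rewrite mcoeff_iota; apply/dhomogP => m'; rewrite msuppC.
by case: ifP => // _; rewrite inE => /eqP ->; rewrite /= mdeg0.
Qed.

Lemma hT_iota d b f : hT d (iota_A b * f) = iota_A b * hT d f.
Proof. by rewrite (grM hT_grading d f (iota_A_hom b)) subn0. Qed.

Lemma hT_X d i f : hT d ('X_i * f) = 'X_i * hT d f.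
Proof. by rewrite (grM hT_grading d f (mpolyX_homT i)) subn0. Qed.

Lemma hT_x d j f : hT d (xT j * f) = if d is e.+1 then xT j * hT e f else 0.
Proof. by rewrite (grM hT_grading d f (xT_hom j)); case: d => [|d] //=; rewrite subn1. Qed.

(** An element of S[c] is also a polynomial in x over the domain K[c], where b can be cancelled. *)
Lemma iota_mulI b (f g : T) : b != 0 -> iota_A b * f = iota_A b * g -> f = g.
Proof.
move=> b0 bfg; apply/mpolyP => m; apply/mpolyP => m'.
pose xc (f : T) : A := map_mpoly (mcoeff m') f.
have xcM f' : xc (iota_A b * f') = b * xc f'.
  apply/mpolyP => k; rewrite mcoeff_map_mpoly /= !mcoeffM raddf_sum /=.
  by apply: eq_bigr => kk _; rewrite mcoeff_iota mcoeffCM mcoeff_map_mpoly.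
have /mpolyP/(_ m) : xc f = xc g by apply: (mulfI b0); rewrite -!xcM bfg.
by rewrite !mcoeff_map_mpoly.
Qed.

Lemma T_ind (P : T -> Prop) : (forall k : K, P (k%:MP : S)%:MP) ->
  (forall j f, P f -> P (xT j * f)) -> (forall i f, P f -> P ('X_i * f)) ->
  (forall f g, P f -> P g -> P (f + g)) -> forall f, P f.
Proof.
move=> PC Px PX PD; apply: mpolyX_ind => // s.
apply: (mpolyX_ind (P := fun s : S => P s%:MP)) => // [j t Pt|t t' Pt Pt'].
  by rewrite mpolyCM; apply: Px.
by rewrite mpolyCD; apply: PD.
Qed.

Lemma subT_const h (k : K) : subT h (k%:MP : S)%:MP = (k%:MP : S)%:MP.
Proof. by rewrite unlock mmapC /= mmapC. Qed.

Lemma subT_x h j : subT h (xT j) = h j.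
Proof. by rewrite unlock mmapC /= mmapX mmap1U. Qed.

Lemma subT_X h i : subT h 'X_i = 'X_i.
Proof. by rewrite unlock mmapX mmap1U. Qed.

Lemma subTM h f g : subT h (f * g) = subT h f * subT h g. Proof. by rewrite unlock; apply: rmorphM. Qed.
Lemma subTD h f g : subT h (f + g) = subT h f + subT h g. Proof. by rewrite unlock; apply: rmorphD. Qed.
Lemma subT_sum h (I : Type) (r : seq I) (P : pred I) F :
  subT h (\sum_(i <- r | P i) F i) = \sum_(i <- r | P i) subT h (F i).
Proof. by rewrite unlock; apply: rmorph_sum. Qed.

Lemma subT_iota h b : subT h (iota_A b) = iota_A b.
Proof.
elim/mpolyX_ind: b => [k|i f IHf|f g IHf IHg].
- by rewrite iota_C subT_const.
- by rewrite iotaM subTM IHf iota_X subT_X.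
- by rewrite iotaD subTD IHf IHg.
Qed.

Definition cmat : 'M[A]_n := \matrix_(i, j) 'X_(mxvec_index i j).

Lemma det_cmat_neq0 : \det cmat != 0.
Proof.
apply/eqP => D0; have := det1 K n; rewrite -[1%:M](_ : map_mx (meval (fun k => mxvec 1%:M 0 k)) cmat = _).
  by rewrite det_map_mx D0 rmorph0 => /esym/eqP; rewrite oner_eq0.
by apply/matrixP => i j; rewrite !mxE mevalXU mxvecE mxE.
Qed.

Lemma zTE i : zT i = \sum_j iota_A (cmat i j) * xT j.
Proof. by apply: eq_bigr => j _; rewrite mxE iota_X. Qed.

Lemma adj_zT j : \sum_k iota_A (\adj cmat j k) * zT k = iota_A (\det cmat) * xT j.
Proof.
under eq_bigr do rewrite zTE mulr_sumr.
rewrite exchange_big /=.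
under eq_bigr => l _.
  under eq_bigr do rewrite mulrA -iotaM.
  rewrite -mulr_suml -iota_sum.
  have /matrixP/(_ j l) := mul_adj_mx cmat; rewrite mxE => ->.
  over.
rewrite (bigD1 j) //= big1 ?addr0 => [|l lj]; first by rewrite mxE eqxx.
by rewrite mxE eq_sym (negbTE lj) mulr0n iota0 mul0r.
Qed.

(** By Cramer's rule det(c) x_j is a combination of the z_k, so inverting det(c) makes (z) N as
    large as m N. *)
Lemma mspan_sat (V : lmodType T) (N : V -> Prop) u : submod N ->
  zspan xT n N u -> sat nzT (zspan zT n N) u.
Proof.
move=> sN [w [Nw ->]]; exists (iota_A (\det cmat)).
  by exists (\det cmat); first exact: det_cmat_neq0.
rewrite scaler_sumr; apply: submod_sum => [|j _]; first exact: zspan_submod.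
rewrite scalerA -adj_zT scaler_suml.
have [_ _ hZ] := zspan_submod zT n sN; apply: submod_sum => [|k _]; first exact: zspan_submod.
by rewrite -scalerA; apply: hZ; apply: zspan_gen.
Qed.

(** Setting x_l = 0 for l < i changes an element only by a member of (x_<i), and turns the
    hypothesis into x_i e(U) = 0, whence e(U) = 0. *)
Lemma xT_reg (i : 'I_n) (U : T) w : xT i * U = \sum_(l < n | (l < i)%N) xT l * w l ->
  exists v, U = \sum_(l < n | (l < i)%N) xT l * v l.
Proof.
move=> xU; pose e := subT (fun j => if (j < i)%N then 0 else xT j).
have eU : e U = 0.
  have := congr1 e xU; rewrite /e subTM subT_sum subT_x ltnn big1 => [|l li].
    move=> /mpolyP xeU; apply/mpolyP => m; have /eqP := xeU m.
    rewrite mcoeffCM !mcoeff0 mulf_eq0 => /orP[|/eqP //].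
    move=> /eqP/(congr1 (mcoeff U_(i))).
    by rewrite mcoeffX eqxx mcoeff0 => /eqP; rewrite oner_eq0.
  by rewrite subTM subT_x li mul0r.
pose P (f : T) := exists v, f - e f = \sum_(l < n | (l < i)%N) xT l * v l.
suff [v vE] : P U by exists v; rewrite -vE eU subr0.
apply: (T_ind (P := P)) => [k|j f [v fE]|j f [v fE]|f g [v fE] [v' gE]].
- exists (fun=> 0); rewrite /e subT_const subrr big1 // => l _; exact: mulr0.
- rewrite /P /e subTM subT_x -/e; case: ltnP => ji.
    rewrite mul0r subr0; exists (fun l => if l == j then f else 0).
    rewrite (bigD1 j) //= eqxx big1 ?addr0 // => l /andP[_ /negbTE ->].
    by rewrite mulr0.
  exists (fun l => xT j * v l); rewrite -mulrBr fE mulr_sumr.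
  by apply: eq_bigr => l _; rewrite mulrCA.
- rewrite /P /e subTM subT_X -/e.
  exists (fun l => 'X_j * v l); rewrite -mulrBr fE mulr_sumr.
  by apply: eq_bigr => l _; rewrite mulrCA.
- exists (fun l => v l + v' l); rewrite /e subTD opprD addrACA -/e fE gE -big_split.
  by apply: eq_bigr => l _; rewrite mulrDr.
Qed.

(* Substituting [adj(c) x] for [x] turns the generic forms into multiples of the variables;
   substituting the generic forms back rescales each degree by a power of det(c). *)
Lemma zT_reg1 (i : 'I_n) (U : 'rV[T]_1) : zspan zT i (fun _ => True) (zT i *: U) ->
  sat nzT (zspan zT i (fun _ => True)) U.
Proof.
move=> [w [_ zU]].
set D := \det cmat; have D0 : D != 0 := det_cmat_neq0.
pose h j := \sum_k iota_A (\adj cmat j k) * xT k.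
have hz j : subT h (zT j) = iota_A D * xT j.
  rewrite zTE subT_sum.
  under eq_bigr do rewrite subTM subT_iota subT_x mulr_sumr.
  rewrite exchange_big /=.
  under eq_bigr => l _.
    under eq_bigr do rewrite mulrA -iotaM.
    rewrite -mulr_suml -iota_sum.
    have /matrixP/(_ j l) := mul_mx_adj cmat; rewrite mxE => ->.
    over.
  rewrite (bigD1 j) //= big1 ?addr0 => [|l lj]; first by rewrite mxE eqxx.
  by rewrite mxE eq_sym (negbTE lj) mulr0n iota0 mul0r.
have zh j : subT zT (h j) = iota_A D * xT j.
  rewrite subT_sum -adj_zT; apply: eq_bigr => k _.
  by rewrite subTM subT_iota subT_x.
have /(congr1 (subT h)) : zT i * U 0 0 = \sum_(l < n | (l < i)%N) zT l * w l 0 0.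
  have /rowP/(_ 0) := zU; rewrite mxE => ->.
  by rewrite summxE; apply: eq_bigr => l _; rewrite mxE.
rewrite subTM hz subT_sum => hU.
have [|v vE] := @xT_reg i (subT h (U 0 0)) (fun l => subT h (w l 0 0)).
  apply: (iota_mulI D0).
  rewrite mulrA. rewrite hU. rewrite mulr_sumr.
  by apply: eq_bigr => l _; rewrite subTM hz mulrA.
pose s f := subT zT (subT h f).
have sU : zspan zT i (fun _ => True) ((s (U 0 0))%:M : 'rV[T]_1).
  exists (fun l => (subT zT (v l))%:M : 'rV[T]_1); split=> //.
  rewrite /s vE subT_sum raddf_sum /=; apply: eq_bigr => l _.
  by rewrite subTM subT_x scale_scalar_mx.
have hs d f : hT d (s f) = iota_A D ^+ d * hT d f.
  elim/T_ind: f d => [k|j f IHf|j f IHf|f g IHf IHg] d.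
  - rewrite /s !subT_const; have hk : homT 0 ((k%:MP : S)%:MP : T).
      apply: mpolyC_homT; apply/dhomogP => m'; rewrite msuppC.
      by case: ifP => // _; rewrite inE => /eqP ->; rewrite /= mdeg0.
    case: d => [|d]; first by rewrite mul1r.
    by rewrite (gr_ne hT_grading hk) // mulr0.
  - rewrite /s subTM subT_x subTM zh -mulrA.
    rewrite hT_iota !hT_x; case: d => [|d]; first by rewrite !mulr0.
    by rewrite -/(s f) IHf exprS -!mulrA; congr (_ * _); rewrite mulrCA.
  - rewrite /s !subTM !subT_X.
    by rewrite !hT_X -/(s f) IHf mulrCA.
  - by rewrite /s !subTD -!/(s _) !hTD IHf IHg mulrDr.
have zg : graded hT (zspan zT i (fun _ : 'rV[T]_1 => True)).
  by apply: (zspan_graded hT_grading zT_hom).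
have [k ->] := hmx_partition hT_grading U.
apply: submod_sum => [|d _]; first by apply: (sat_submod (@nzT_mult K n)); case: zg.
exists (iota_A (D ^+ d)); first by exists (D ^+ d); rewrite ?expf_neq0.
have := zg.2 d _ sU; congr (zspan _ _ _ _).
by apply/rowP => j; rewrite !ord1 !mxE eqxx mulr1n hs iota_exp.
Qed.

Lemma zT_reg c (i : 'I_n) (U : 'rV[T]_c) : zspan zT i (fun _ => True) (zT i *: U) ->
  sat nzT (zspan zT i (fun _ => True)) U.
Proof.
move=> [w [_ zU]]; have -> : U = \sum_k U 0 k *: delta_mx 0 k := row_sum_delta U.
apply: submod_sum => [|k _]; first by apply: (sat_submod (@nzT_mult K n)); apply: zspan_submod.
have [|b b0 [v [_ bU]]] := @zT_reg1 i (U 0 k)%:M.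
  exists (fun l => (w l 0 k)%:M); split=> //.
  have /rowP/(_ k) := zU; rewrite scale_scalar_mx summxE mxE => ->.
  rewrite [LHS]raddf_sum; apply: eq_bigr => l _.
  by rewrite /= mxE -scale_scalar_mx.
exists b => //; exists (fun l => v l 0 0 *: delta_mx 0 k); split=> //.
have /matrixP/(_ 0 0) := bU; rewrite !mxE eqxx mulr1n scalerA => ->.
rewrite summxE scaler_suml; apply: eq_bigr => l _.
by rewrite scalerA mxE.
Qed.
End GenericRegular.

(** * Transfer of the d-sequence property along a linear resolution *)

Section RegularityChain.
Variables (R : comRingType) (B : R -> Prop) (mB : mult_closed B).
Variables (h : nat -> R -> R) (hom : nat -> R -> Prop) (gr : grading h hom).
Variables (n : nat) (x z : 'I_n -> R).
Hypotheses (xh : forall l, hom 1 (x l)) (zh : forall l, hom 1 (z l)).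
Local Notation hmxR := (hmx h).
Local Notation mF := (zspan x n (fun _ => True)).
Local Notation sat := (sat B).
Hypothesis pos_mF : forall c (v : 'rV[R]_c), hmxR 0 v = 0 -> mF v.
Hypothesis mspan_sat : forall c (N : 'rV[R]_c -> Prop) v, submod N ->
  zspan x n N v -> sat (zspan z n N) v.
Hypothesis z_reg : forall c (i : 'I_n) (U : 'rV[R]_c),
  zspan z i (fun _ => True) (z i *: U) -> sat (zspan z i (fun _ => True)) U.

(* For a syzygy module N of F = R^b, this says that N ∩ (z_<i) m F = (z_<i) N up to B. *)
Definition syz_sat b (N : 'rV[R]_b -> Prop) i : Prop :=
  forall u, zspan z i mF u -> N u -> sat (zspan z i N) u.

(** The d-sequence property up to B. The first membership is in m N because the z_l generate m only
    after saturation. *)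
Definition dseq_sat c (N : 'rV[R]_c -> Prop) (i : 'I_n) : Prop :=
  forall u, zspan x n N u -> sat (zspan z i N) (z i *: u) -> sat (zspan z i N) u.

Lemma dseq_sat_pow c (N : 'rV[R]_c -> Prop) i t u : submod N -> dseq_sat N i ->
  zspan x n N u -> sat (zspan z i N) (z i ^+ t *: u) -> sat (zspan z i N) u.
Proof.
move=> sN dN mu; elim: t => [|t IHt]; first by rewrite expr0 scale1r.
rewrite exprS -scalerA => /dN su; apply/IHt/su.
by have [_ _ hZ] := zspan_submod x n sN; apply: hZ.
Qed.

Section Presentation.
Variables (a b : nat) (G : 'M[R]_(a, b)).
Hypothesis hG : hommx hom 1 G.
Local Notation Z := (rspan G).

Lemma rspan_graded : graded h Z.
Proof.
split=> [|d v [w ->]]; first exact: rspan_submod.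
rewrite (hmxM gr _ _ hG); case: ifP => _; last by exists 0; rewrite mul0mx.
by exists (hmxR (d - 1) w).
Qed.

(** Here u has no component of degree below 2, so for u = w G with G linear the constant part of w
    is killed by G and can be removed from w. *)
Lemma linear_gen u : zspan z n mF u -> Z u -> zspan x n Z u.
Proof.
move=> mmu [w uE].
have h1 : hmxR 1 u = 0.
  have gF : graded h (fun u : 'rV[R]_b => mF u) by apply: (zspan_graded gr xh).
  have [y [hy ->]] := zspan_hmxS gr zh 0 gF mmu.
  rewrite big1 // => l _; have [my h0y] := hy l.
  by rewrite -(hmx_id gr h0y) (zspan_hmx0 gr xh my) scaler0.
have w0 : hmxR 0 w *m G = 0.
  by have := hmxM gr 1 w hG; rewrite -uE h1 => /esym.
have -> : u = (w - hmxR 0 w) *m G by rewrite mulmxBl [X in _ - X]w0 subr0 -uE.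
apply: (@zspan_mulmx _ _ _ _ _ _ _ (fun _ => True)) => [v _|]; first by exists v.
exact/pos_mF/(hmx_residue gr).
Qed.

Lemma syz_sat_top : syz_sat Z n.
Proof.
move=> u mmu Zu; apply: mspan_sat; first exact: rspan_submod.
exact: linear_gen.
Qed.

(** u lies in m Z by [linear_gen], so the power of z_i that torsion supplies can be cancelled by the
    d-sequence property. *)
Lemma dseq_sat_syz_sat (i : 'I_n) :
  (forall u, zspan z i (fun _ => True) u -> Z u -> exists t, zspan z i Z (z i ^+ t *: u)) ->
  dseq_sat Z i -> syz_sat Z i.
Proof.
move=> Z_torsion dZ u zu Zu.
have sZ := rspan_submod G.
have mZu : zspan x n Z u.
  apply: linear_gen => //; apply: zspan_le zu; first exact: zspan_submod.
  exact/ltnW/ltn_ord.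
have [t ht] := Z_torsion u (zspan_sub (fun _ _ => I) zu) Zu.
apply: (dseq_sat_pow (t := t)) => //; exact: sat_in.
Qed.

Variables (c : nat) (H : 'M[R]_(b, c)).
Hypothesis exH : forall v : 'rV[R]_b, v *m H = 0 <-> rspan G v.

(** Lift u = U H with U in m F, and let zeta be the syzygy z_i e U - sum z_l W_l. The hypothesis at
    i + 1 splits off z_i ze with ze in Z. Then z_i sends e' e U - ze into (z_<i) F, so by regularity
    this element itself is in (z_<i) F up to B, and applying H removes ze. *)
Lemma syz_sat_dseq_sat (i : 'I_n) : syz_sat Z i.+1 -> dseq_sat (rspan H) i.
Proof.
move=> qZ u mu [e e0 [y [Ny yE]]].
have [U mU uE] : exists2 U, mF U & u = U *m H.
  have [v [hv ->]] := mu; have [V hV] := choice _ hv.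
  exists (\sum_(l < n | (l < n)%N) x l *: V l); first by exists V.
  by rewrite mulmx_suml; apply: eq_bigr => l _; rewrite -scalemxAl -hV.
have [W hW] := choice _ Ny.
pose zeta := z i *: (e *: U) - \sum_(l < n | (l < i)%N) z l *: W l.
have sF : submod (fun u : 'rV[R]_b => mF u) by apply: zspan_submod.
have meU : mF (e *: U) by have [_ _ hZ] := sF; apply: hZ.
have Zz : Z zeta.
  apply/exH; rewrite mulmxBl -!scalemxAl -uE scalerA [z i * _]mulrC -scalerA yE.
  rewrite mulmx_suml; apply/eqP; rewrite subr_eq0; apply/eqP.
  by apply: eq_bigr => l _; rewrite -scalemxAl -hW.
(* The W_l need not lie in m F. Dropping their constant parts removes exactly the degree 1 component
   of zeta, which is itself in Z. *)
pose W1 l := W l - hmxR 0 (W l).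
have zeta1 : hmxR 1 zeta = - \sum_(l < n | (l < i)%N) z l *: hmxR 0 (W l).
  have -> : zeta = z i *: (e *: U) + \sum_(l < n | (l < i)%N) z l *: (- W l).
    by rewrite /zeta -sumrN; congr (_ + _); apply: eq_bigr => l _; rewrite scalerN.
  rewrite (hmxD gr) (hmxZ gr _ _ (zh i)) /= (zspan_hmx0 gr xh meU) scaler0 add0r.
  rewrite (hmx_sum gr) -sumrN; apply: eq_bigr => l _.
  rewrite (hmxZ gr _ _ (zh l)) /= -scalerN; congr (_ *: _).
  exact: (hmxN gr).
have zE : zeta - hmxR 1 zeta = z i *: (e *: U) - \sum_(l < n | (l < i)%N) z l *: W1 l.
  rewrite zeta1 opprK -addrA; congr (_ + _); rewrite addrC.
  by rewrite -sumrB -sumrN; apply: eq_bigr => l _; rewrite -scalerBr -scalerN opprB.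
have mW1 l : mF (W1 l) by exact/pos_mF/(hmx_residue gr).
have [||e' e'0 hz] := qZ (zeta - hmxR 1 zeta).
- rewrite zE; apply: submod_sub; first exact: zspan_submod.
    by apply: zspan_gen.
  apply: (zspan_le sF (leqnSn i)); exists W1; split=> //.
- exact: (submod_sub (rspan_submod G) Zz (rspan_graded.2 1%N _ Zz)).
have [v [ze [zv Zze hE]]] := @zspanS _ _ _ _ i _ _ hz.
have [e2 e20 [y' [_ hh]]] : sat (zspan z i (fun _ => True)) (e' *: (e *: U) - ze).
  apply: z_reg.
  have -> : z i *: (e' *: (e *: U) - ze) =
      v + e' *: \sum_(l < n | (l < i)%N) z l *: W1 l.
    have zU : z i *: (e *: U) = (zeta - hmxR 1 zeta) + \sum_(l < n | (l < i)%N) z l *: W1 l.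
      by rewrite zE subrK.
    by rewrite scalerBr [z i *: (e' *: _)]scalerA [z i * e']mulrC -scalerA zU scalerDr hE addrAC addrK.
  have [_ hD hZ] := zspan_submod z i (true_submod 'rV[R]_b); apply: hD.
    by apply: zspan_sub zv.
  by apply: hZ; exists W1.
exists (e2 * e' * e); first by do 2?apply: mB.2.
exists (fun l => y' l *m H); split=> [l|]; first by exists (y' l).
have zeH : ze *m H = 0 by apply/exH.
transitivity ((e2 *: (e' *: (e *: U) - ze)) *m H).
  by rewrite -scalemxAl mulmxBl zeH subr0 -!scalemxAl -uE !scalerA.
by rewrite hh mulmx_suml; apply: eq_bigr => l _; rewrite -scalemxAl.
Qed.
End Presentation.

Variables (c : nat) (b : nat -> nat) (g : 'M[R]_(b 0, c)) (G : forall p, 'M[R]_(b p.+1, b p)).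
Hypothesis hG : forall p, hommx hom 1 (G p).
Hypothesis exg : forall v : 'rV[R]_(b 0), v *m g = 0 <-> rspan (G 0) v.
Hypothesis exG : forall p (v : 'rV[R]_(b p.+1)), v *m G p = 0 <-> rspan (G p.+1) v.
Hypothesis G_torsion : forall p (i : 'I_n) u, zspan z i (fun _ => True) u ->
  rspan (G p) u -> exists t, zspan z i (rspan (G p)) (z i ^+ t *: u).

(** Going from j + 1 to j uses the next syzygy module, so the claim is proved for all p at once; at
    j = n it holds because the presentations are linear. *)
Lemma linear_chain_dseq_sat (i : 'I_n) : dseq_sat (rspan g) i.
Proof.
suff Q : forall k j, (n - j <= k)%N -> (j <= n)%N -> forall p, syz_sat (rspan (G p)) j.
  by apply: (syz_sat_dseq_sat (@hG 0%N) exg); apply: Q (leqnn _) _ _; apply: ltn_ord.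
elim=> [|k IHk] j jk jn p.
  have -> : j = n by apply/eqP; rewrite eqn_leq jn -subn_eq0 -leqn0.
  exact: (syz_sat_top (@hG p)).
move: jn; rewrite leq_eqVlt => /predU1P[->|jn]; first exact: (syz_sat_top (@hG p)).
pose o := Ordinal jn; apply: (dseq_sat_syz_sat (@hG p) (i := o)) => //; first exact: G_torsion.
apply: (syz_sat_dseq_sat (@hG p.+1) (exG (p := p))); apply: IHk => //.
by rewrite subnS -ltnS prednK // subn_gt0.
Qed.
End RegularityChain.

(** * The generic d-sequence property of componentwise linear ideals *)

Section GenericDsequence.
Variables (K : fieldType) (n : nat).
Local Notation S := {mpoly K[n]}.
Local Notation A := {mpoly K[n * n]}.
Local Notation T := {mpoly S[n * n]}.
Local Notation xT := (@xT K n).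
Local Notation zT := (@zT K n).
Local Notation nzT := (@nzT K n).
Local Notation hT := (@hT K n).
Local Notation homT := (@homT K n).
Local Notation cst := (map_mx (@mpolyC (n * n) S)).
Local Notation grT := (@hT_grading K n).
Local Notation zh := (@zT_hom K n).
Local Notation xh := (@xT_hom K n).
Local Notation homS := (fun d (p : S) => p \is d.-homog).

Lemma hmxT0_mF c (v : 'rV[T]_c) : hmx hT 0 v = 0 -> zspan xT n (fun _ => True) v.
Proof.
move=> v0; apply: ext_ind => [|m]; first exact: zspan_submod.
have v0m : hmx (fun d (p : S) => pihomog mdeg d p) 0 (map_mx (mcoeff m) v) = 0.
  apply/rowP => i; have /rowP/(_ i) := v0; rewrite !mxE => /mpolyP/(_ m).
  by rewrite mcoeff_hT mcoeff0.
have [w [_ ->]] := X_span_pos v0m.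
exists (fun j => cst (w j)); split=> //.
apply/rowP => i; rewrite mxE !summxE raddf_sum; apply: eq_bigr => j _.
by rewrite !mxE /= mpolyCM.
Qed.

Lemma ext_rspan_torsion b c (G : 'M[S]_(b, c)) (P : 'rV[S]_c -> Prop) (i : 'I_n) u :
  submod P ->
  zspan zT i (ext P) u -> rspan (cst G) u -> exists t, zspan zT i (rspan (cst G)) (zT i ^+ t *: u).
Proof.
move=> sP zu Gu.
have [|t ht] := zspan_torsion sP (rspan_submod G) i (ltnW (ltn_ord i)) zu.
  by apply/ext_rspan.
by exists t; apply: zspan_sub ht => v /ext_rspan.
Qed.

Lemma linear_resolution_dseq_sat e (N : S -> Prop) : linear_resolution e N ->
  exists (b : nat) (g : 'cV[S]_b), [/\ hommx homS e g,
    forall p, N p <-> exists v : 'rV[S]_b, p = (v *m g) 0 0 &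
    forall i, dseq_sat nzT xT zT (rspan (cst g)) i].
Proof.
move=> [b [g [G [hg Ng hG exg exG]]]]; exists (b 0%N), g; split=> [r s|//|i].
  by rewrite ord1; apply: hg.
apply: (@linear_chain_dseq_sat T nzT (@nzT_mult K n) hT homT grT n xT zT xh zh hmxT0_mF
  (fun c V v => @mspan_sat K n _ V v) (@zT_reg K n) 1 b (cst g) (fun p => cst (G p))).
- by move=> p; apply: cst_homT => r s; apply: hG.
- exact: ext_exact exg.
- by move=> p; apply: ext_exact (exG p).
move=> p j u zu Gu; apply: (ext_rspan_torsion (P := fun _ => True)) Gu => //.
by apply: zspan_sub zu.
Qed.

(** The component of u of degree e + 1 lies in m J_<e>, but its relation z_i u in (z_<i) J has
    coefficients in J. The torsion lemma for the pair J, J_<e> moves the relation to J_<e> at the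
    cost of a power of z_i, which the d-sequence property on J_<e> cancels. *)
Lemma generic_dseq_componentwise_linear (J : S -> Prop) (i : 'I_n) (u : 'rV[T]_1) :
  graded_ideal J -> componentwise_linear J ->
  zspan xT n (ext (ivec J)) u -> zspan zT i (ext (ivec J)) (zT i *: u) ->
  sat nzT (zspan zT i (ext (ivec J))) u.
Proof.
move=> [iJ gJ] cJ mu zu.
have sJ := ivec_submod iJ; have sE := @ext_submod _ (n * n) _ _ sJ.
have gE : graded hT (ext (ivec J)).
  split=> // d v Jv m; have := gJ _ d (Jv m); rewrite /ivec !mxE.
  by rewrite mcoeff_hT.
have [k ->] := hmx_partition grT u.
have sM : submod (sat nzT (zspan zT i (ext (ivec J)))).
  by apply: (sat_submod (@nzT_mult K n)); apply: zspan_submod.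
apply: submod_sum => // -[[|e] _] _ /=.
  by rewrite (zspan_hmx0 grT xh mu); case: sM.
have [b [g [hg Ng dN]]] := linear_resolution_dseq_sat (cJ e).
have gJ' v : rspan g v -> ivec J v.
  move=> [w ->]; have /Ng : exists v : 'rV_b, (w *m g) ord0 ord0 = (v *m g) ord0 ord0 by exists w.
  by apply: gen_ideal_min => // p [].
have sN := rspan_submod (cst g).
have mNu : zspan xT n (rspan (cst g)) (hmx hT e.+1 u).
  apply: zspan_sub (zspan_hmxS grT xh e gE mu) => v [Jv hv]; apply/ext_rspan => m.
  have /Ng[w wE] : gen_ideal (fun p => J p /\ p \is e.-homog) ((map_mx (mcoeff m) v) 0 0).
    by apply: gen_ideal_gen; split; [apply: Jv|rewrite mxE; apply: hv].
  by exists w; apply/rowP => j; rewrite ord1.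
have zJ : zspan zT i (ext (ivec J)) (zT i *: hmx hT e.+1 u).
  have := (zspan_graded grT zh i gE).2 e.+2 _ zu.
  by rewrite (hmxZ grT _ _ (zh i)) /= subn1.
have Nz : rspan (cst g) (zT i *: hmx hT e.+1 u).
  by have [_ _ hZ] := sN; apply: hZ; apply: zspan_in mNu.
have [t ht] := ext_rspan_torsion sJ zJ Nz.
apply: (@sat_sub _ _ _ (zspan zT i (rspan (cst g)))) => [v|].
  by apply: zspan_sub => w /ext_rspan; apply: ext_mono.
apply: (dseq_sat_pow (t := t.+1)) (dN i) mNu _ => //.
by rewrite exprSr -scalerA; apply: (sat_in (@nzT_mult K n)).
Qed.
End GenericDsequence.

(** * Generic freeness *)

Section Dickson.
Variable N : nat.

(** Induction on the number j of coordinates compared. A finite set [s0] for j coordinates also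
    dominates every m whose next coordinate is at least the maximum M over [s0]; the smaller values
    of that coordinate give finitely many slices. *)
Lemma dickson (E : 'X_{1..N} -> Prop) : exists s : seq 'X_{1..N},
  (forall m, m \in s -> E m) /\ forall m, E m -> exists2 m', m' \in s & (m' <= m)%MM.
Proof.
suff h : forall j (E : 'X_{1..N} -> Prop), (j <= N)%N -> exists s : seq 'X_{1..N},
    (forall m, m \in s -> E m) /\
    forall m, E m -> exists2 m', m' \in s & forall i : 'I_N, (i < j)%N -> (m' i <= m i)%N.
  have [s [sE hs]] := h N E (leqnn N); exists s; split=> // m /hs[m' m's le].
  by exists m' => //; apply/mnm_lepP => i; apply: le.
elim=> [|j IHj] {}E jN.
  case: (classic (exists m, E m)) => [[m Em]|nE]; last by exists [::]; split=> // m Em; case: nE; exists m.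
  by exists [:: m]; split=> [m'|m' _]; [rewrite inE => /eqP ->|exists m; rewrite ?inE].
pose o := Ordinal jN; have [s0 [s0E hs0]] := IHj E (ltnW jN).
have [s hs] := choice _ (fun v => IHj (fun m => E m /\ m o = v) (ltnW jN)).
pose M := (\max_(m <- s0) m o)%N.
exists (s0 ++ flatten [seq s v | v <- iota 0 M]); split=> [m|m Em].
  rewrite mem_cat => /orP[/s0E //|/flattenP[_ /mapP[v _ ->]]].
  by move=> /(hs v).1 [].
have [lt|ge] := ltnP (m o) M.
  have [m' m's le] := (hs (m o)).2 m (conj Em erefl).
  exists m'.
    rewrite mem_cat; apply/orP; right; apply/flattenP; exists (s (m o)) => //.
    by apply: map_f; rewrite mem_iota.
  move=> i; rewrite ltnS leq_eqVlt => /predU1P[ij|/le //].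
  have -> : i = o by apply: val_inj.
  by rewrite ((hs (m o)).1 m' m's).2.
have [m' m's le] := hs0 m Em; exists m'; first by rewrite mem_cat m's.
move=> i; rewrite ltnS leq_eqVlt => /predU1P[ij|/le //].
have -> : i = o by apply: val_inj.
apply: leq_trans ge; rewrite /M; elim: s0 m's {s0E hs0 M} => // m0 s0 IHs.
rewrite inE big_cons leq_max => /predU1P[->|/IHs ->]; by rewrite ?leqnn ?orbT.
Qed.
End Dickson.

Section GenericFreeness.
Import Order.TTheory.
Variables (A : idomainType) (N : nat).
Local Notation P := {mpoly A[N]}.

Definition lincomb (gs : seq P) (f : P) : Prop :=
  exists h : nat -> P, f = \sum_(i < size gs) h i * gs`_i.

Lemma lincomb0 gs : lincomb gs 0.
Proof. by exists (fun=> 0); rewrite big1 // => i _; rewrite mul0r. Qed.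

Lemma lincombD gs f g : lincomb gs f -> lincomb gs g -> lincomb gs (f + g).
Proof.
move=> [h ->] [h' ->]; exists (fun i => h i + h' i); rewrite -big_split.
by apply: eq_bigr => i _; rewrite mulrDl.
Qed.

Lemma lincombZ gs c f : lincomb gs f -> lincomb gs (c *: f).
Proof.
move=> [h ->]; exists (fun i => c *: h i); rewrite scaler_sumr.
by apply: eq_bigr => i _; rewrite scalerAl.
Qed.

Lemma lincomb_gen gs c g : g \in gs -> lincomb gs (c * g).
Proof.
move=> gg; exists (fun i => if i == index g gs then c else 0).
have lt : (index g gs < size gs)%N by rewrite index_mem.
rewrite (bigD1 (Ordinal lt)) //= eqxx nth_index // big1 ?addr0 // => i ne.
case: eqP => [ig|_]; last by rewrite mul0r.
by case/eqP: ne; apply: val_inj.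
Qed.

Definition off (E : 'X_{1..N} -> Prop) (q : P) : Prop := forall m, q@_m != 0 -> ~ E m.

Lemma offD E q q' : off E q -> off E q' -> off E (q + q').
Proof.
move=> hq hq' m; rewrite mcoeffD => nz; case: (eqVneq q@_m 0) => [q0|/hq //].
by apply: hq'; rewrite q0 add0r in nz.
Qed.

Lemma offZ E c q : off E q -> off E (c *: q).
Proof.
by move=> hq m; rewrite mcoeffZ => nz; apply: hq; apply: contraNneq nz => ->; rewrite mulr0.
Qed.

Lemma off_sum E (I : Type) (r : seq I) (Q : pred I) F :
  (forall i, Q i -> off E (F i)) -> off E (\sum_(i <- r | Q i) F i).
Proof.
move=> hF; apply: (big_ind (off E)) => //; last exact: offD.
by move=> m; rewrite mcoeff0 eqxx.
Qed.

(* Division by finitely many elements of J whose leading monomials generate all the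
   leading monomials of J; only powers of the product [a] of their leading coefficients
   are needed as denominators. *)
Lemma generic_freeness (J : P -> Prop) : J 0 -> (forall f g, J f -> J g -> J (f + g)) ->
  (forall c f, J f -> J (c * f)) ->
  exists a gs E, [/\ a != 0, forall g, g \in gs -> J g, forall q, J q -> off E q -> q = 0 &
    forall p, exists k, forall k', (k <= k')%N ->
      exists2 q, off E q & lincomb gs (a ^+ k' *: p - q)].
Proof.
move=> J0 JD JM; pose E m := exists p, [/\ J p, p != 0 & mlead p = m].
have [s [sE hs]] := dickson E.
have [gs [gsJ gs0 hgs]] : exists gs : seq P, [/\ forall g, g \in gs -> J g,
    forall g, g \in gs -> g != 0 & forall m, m \in s -> exists2 g, g \in gs & mlead g = m].
  elim: s sE {hs} => [|m s IHs] sE; first by exists [::].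
  have [|gs [gsJ gs0 hgs]] := IHs; first by move=> m' m's; apply: sE; rewrite inE m's orbT.
  have [p [Jp p0 pm]] := sE m (mem_head m s).
  exists (p :: gs); split=> [g|g|m']; rewrite ?inE.
  - by case/predU1P => [->|/gsJ].
  - by case/predU1P => [->|/gs0].
  case/predU1P => [->|/hgs[g gg <-]]; first by exists p; rewrite ?mem_head.
  by exists g; rewrite // inE gg orbT.
pose a : A := \prod_(g <- gs) mleadc g.
have a0 : a != 0.
  by rewrite /a prodf_seq_neq0; apply/allP => g /gs0; rewrite mleadc_eq0.
have aE g : g \in gs -> exists a', a = a' * mleadc g.
  move=> gg; exists (\prod_(g' <- rem g gs) mleadc g').
  by rewrite /a (perm_big _ (perm_to_rem gg)) big_cons mulrC.
exists a, gs, E; split=> // [q Jq hq|p].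
  apply/eqP; apply: contraT => q0; case: (hq (mlead q)); first by rewrite mleadc_eq0.
  by exists q.
(* Further powers of a scale q and the combination alike. Having all large k' lets finitely many p
   share one exponent. *)
suff [k [q [hq lc]]] : exists k q, off E q /\ lincomb gs (a ^+ k *: p - q).
  exists k => k' kk'; exists (a ^+ (k' - k) *: q); first exact: offZ.
  have -> : a ^+ k' *: p - a ^+ (k' - k) *: q = a ^+ (k' - k) *: (a ^+ k *: p - q).
    by rewrite scalerBr scalerA -exprD subnK.
  exact: lincombZ.
suff IH : forall m (p : P), (forall m', p@_m' != 0 -> (m' <= m)%O) ->
    exists k q, off E q /\ lincomb gs (a ^+ k *: p - q).
  by apply: (IH (mlead p)) => m'; rewrite -mcoeff_msupp => /msupp_le_mlead.
clear p; elim/(@ltmwf N) => m IH p hp.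
have IH' (p' : P) : (forall m', p'@_m' != 0 -> (m' <= m)%O) -> p'@_m = 0 ->
    exists k q, off E q /\ lincomb gs (a ^+ k *: p' - q).
  move=> hp' p'm; case: (eqVneq p' 0) => [->|p'0].
    exists 0%N, 0; split; first by move=> m'; rewrite mcoeff0 eqxx.
    by rewrite scaler0 subr0; apply: lincomb0.
  apply: (IH (mlead p')); last by move=> m'; rewrite -mcoeff_msupp => /msupp_le_mlead.
  rewrite lt_neqAle hp' ?mleadc_eq0 // andbT; apply: contraNneq p'0 => ml.
  by rewrite -mleadc_eq0 ml p'm.
(* If a leading monomial from [gs] divides m, the term at m is cancelled after one multiplication by
   a; otherwise m is no leading monomial of J and its term joins the remainder. *)
have [[g gg gm]|ng] := classic (exists2 g, g \in gs & (mlead g <= m)%MM).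
  have [a' a'E] := aE g gg.
  pose t := (a' * p@_m) *: 'X_[m - mlead g] * g.
  have tm m' : t@_m' != 0 -> (m' <= m)%O.
    rewrite -mcoeff_msupp => /msuppM_le/allpairsP[[m1 m2] /= [h1 h2 ->]].
    have := msuppZ_le h1; rewrite msuppX inE => /eqP ->.
    rewrite -{2}(submK gm) lemc_add2r; exact: msupp_le_mlead.
  have [||k [q [hq lc]]] := IH' (a *: p - t).
  - move=> m'; rewrite mcoeffB mcoeffZ => nz.
    case: (eqVneq t@_m' 0) => [t0|/tm //]; apply: hp.
    by apply: contraNneq nz => ->; rewrite t0 mulr0 subr0.
  - have Xg : ('X_[m - mlead g] * g)@_m = mleadc g.
      by rewrite mulrC -[X in _@_X](submK gm) mcoeffMX.
    by rewrite mcoeffB mcoeffZ /t -scalerAl mcoeffZ Xg a'E mulrAC subrr.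
  exists k.+1, q; split=> //.
  have -> : a ^+ k.+1 *: p - q = (a ^+ k *: (a *: p - t) - q) + a ^+ k *: t.
    by rewrite exprSr -scalerA scalerBr [in RHS]addrAC subrK.
  by apply: lincombD => //; apply: lincombZ; apply: lincomb_gen.
have nE : ~ E m.
  move=> /hs[m' /hgs[g gg gm'] m'm]; case: ng; exists g => //; by rewrite gm'.
have cX m' : (p@_m *: 'X_[m] : P)@_m' = if m' == m then p@_m else 0.
  by rewrite mcoeffZ mcoeffX eq_sym; case: eqP => _; rewrite ?mulr1 ?mulr0.
have [||k [q [hq lc]]] := IH' (p - p@_m *: 'X_[m]).
- move=> m'; rewrite mcoeffB cX; case: (eqVneq m' m) => [-> //|_]; rewrite subr0; exact: hp.
- by rewrite mcoeffB cX eqxx subrr.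
exists k, (q + a ^+ k *: (p@_m *: 'X_[m])); split.
  apply: offD => //; apply: offZ => m'; rewrite cX; case: (eqVneq m' m) => [-> //|_].
  by rewrite eqxx.
by rewrite opprD addrA addrAC -scalerBr.
Qed.
End GenericFreeness.

(** * Nonvanishing points over an infinite field *)

Section Nonvanishing.
Variables (K : fieldType) (N : nat).
Hypothesis K_inf : infinite_type K.
Local Notation P := {mpoly K[N]}.

(** The variables are specialized one at a time: as a polynomial in one variable over the others, a
    nonzero polynomial has finitely many constant roots. *)
Lemma mpoly_nonroot (f : P) : f != 0 -> exists v, f.@[v] != 0.
Proof.
move=> f0; pose sb (s : seq 'I_N) (c : 'I_N -> K) (i : 'I_N) : P := if i \in s then (c i)%:MP else 'X_i.
suff [c hc] : exists c, mmap (@mpolyC N K) (sb (enum 'I_N) c) f != 0.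
  exists c; apply: contraNneq hc => fc.
  have -> : mmap (@mpolyC N K) (sb (enum 'I_N) c) f = (f.@[c])%:MP.
    elim/mpolyX_ind: (f) => [k|i q IHq|q q' IHq IHq'].
    - by rewrite mmapC mevalC.
    - by rewrite rmorphM /= IHq mmapX mmap1U mevalM mevalXU mpolyCM /sb mem_enum.
    - by rewrite rmorphD /= IHq IHq' mevalD mpolyCD.
  by rewrite fc mpolyC0.
elim: (enum 'I_N) => [|k s [c hc]].
  exists (fun=> 0); suff -> : mmap (@mpolyC N K) (sb [::] (fun=> 0)) f = f by [].
  elim/mpolyX_ind: (f) => [k|i q IHq|q q' IHq IHq'].
  - by rewrite mmapC.
  - by rewrite rmorphM /= IHq mmapX mmap1U.
  - by rewrite rmorphD /= IHq IHq'.
set g := mmap _ _ f in hc.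
(* [ph] reads a polynomial as one in X_k with the other variables in the coefficients; evaluation at
   X_k undoes it. *)
have [ph [phC phX phM phD]] : exists ph : P -> {poly P}, [/\ forall a, ph a%:MP = (a%:MP)%:P,
    forall i, ph 'X_i = if i == k then 'X else ('X_i)%:P,
    forall q q', ph (q * q') = ph q * ph q' & forall q q', ph (q + q') = ph q + ph q'].
  exists (mmap (polyC \o @mpolyC N K) (fun i => if i == k then 'X else ('X_i)%:P)); split.
  - by move=> a; rewrite mmapC.
  - by move=> i; rewrite mmapX mmap1U.
  - by move=> q q'; apply: rmorphM.
  - by move=> q q'; apply: rmorphD.
have phK q : (ph q).['X_k] = q.
  elim/mpolyX_ind: q => [a|i q IHq|q q' IHq IHq'].
  - by rewrite phC hornerC.
  - by rewrite phM phX hornerM IHq; case: eqP => [->|_]; rewrite ?hornerX ?hornerC.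
  - by rewrite phD hornerD IHq IHq'.
have ph0 : ph g != 0 by apply: contraNneq hc => p0; rewrite -[g]phK p0 horner0.
have [a ha] : exists a : K, (ph g).[a%:MP] != 0.
  apply: NNPP => na.
  have all_root a : root (ph g) a%:MP.
    by rewrite /root; apply: contraT => h; case: na; exists a.
  have : forall r, exists s : seq K, uniq s /\ size s = r.
    elim=> [|r [t [ut st]]]; first by exists [::].
    by have [b bt] := K_inf t; exists (b :: t); rewrite /= bt ut st.
  move=> /(_ (size (ph g)))[t [ut st]].
  have := @max_poly_roots _ (ph g) [seq b%:MP | b <- t] ph0.
  rewrite size_map st ltnn => h; suff : false by [].
  apply: h; first by apply/allP => _ /mapP[b _ ->].
  by rewrite map_inj_uniq // => b b' /eqP; rewrite mpolyC_eq => /eqP.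
pose c' i := if i \in s then c i else a.
exists c'; suff -> : mmap (@mpolyC N K) (sb (k :: s) c') f = (ph g).[a%:MP] by [].
rewrite /g; elim/mpolyX_ind: (f) => [b|i q IHq|q q' IHq IHq'].
- by rewrite !mmapC phC hornerC.
- rewrite !rmorphM /= IHq phM hornerM; congr (_ * _).
  rewrite !mmapX !mmap1U /sb inE /c'.
  case: (boolP (i \in s)) => is_; rewrite ?orbT ?orbF ?phC ?hornerC // phX.
  by case: eqP => _; rewrite ?hornerX ?hornerC.
- by rewrite !rmorphD /= IHq IHq' phD hornerD.
Qed.
End Nonvanishing.

Section GenericFlatness.
Variables (A : idomainType) (N : nat) (V : zmodType).
Local Notation P := {mpoly A[N]}.
Variables (pi : P -> V) (act : A -> V -> V) (D : V -> Prop).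
Hypotheses (piD : forall f g, pi (f + g) = pi f + pi g)
  (piZ : forall c f, pi (c *: f) = act c (pi f)).
Hypotheses (D0 : D 0) (DD : forall u v, D u -> D v -> D (u + v))
  (DM : forall c f, D (pi f) -> D (pi (c * f))).

Lemma pi0 : pi 0 = 0.
Proof. by apply: (addrI (pi 0)); rewrite -piD !addr0. Qed.

Lemma piB f g : pi (f - g) = pi f - pi g.
Proof. by apply/eqP; rewrite eq_sym subr_eq -piD subrK. Qed.

Lemma pi_sum (I : Type) (r : seq I) (Q : pred I) F :
  pi (\sum_(i <- r | Q i) F i) = \sum_(i <- r | Q i) pi (F i).
Proof. exact: (big_morph pi piD pi0). Qed.

(* V / D becomes free over A after inverting [a]; hence relations modulo D with
   coefficients in A lift, and its A-torsion is killed by powers of [a]. *)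
Lemma generic_flatness : exists a, [/\ a != 0,
  forall (I : finType) (W : I -> V) (c : I -> A), (forall i, exists p, W i = pi p) ->
    D (\sum_i act (c i) (W i)) -> exists k (W' : I -> V), (forall i, D (W' i)) /\
    \sum_i act (c i) (act (a ^+ k) (W i)) = \sum_i act (c i) (W' i) &
  forall v b, (exists p, v = pi p) -> b != 0 -> D (act b v) -> exists k, D (act (a ^+ k) v)].
Proof.
have [|f g|c f|a [gs [E [a0 gsJ Joff div]]]] := @generic_freeness A N (fun f => D (pi f)).
- by rewrite pi0.
- by rewrite piD; apply: DD.
- exact: DM.
have lcJ f : lincomb gs f -> D (pi f).
  move=> [h ->]; rewrite pi_sum; apply: (big_ind D) => // i _; apply: DM.
  by apply/gsJ/mem_nth.
have JZ c f : D (pi f) -> D (pi (c *: f)) by rewrite -mul_mpolyC; apply: DM.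
exists a; split=> // [I W c liftW DW|v b [p ->] b0 Dbv].
  have [p hp] := choice _ liftW.
  have [k hk] := choice _ (fun i => div (p i)).
  pose k' := (\max_i k i)%N.
  have hq i : exists q, off E q /\ lincomb gs (a ^+ k' *: p i - q).
    by have [|q hq lq] := hk i k'; [apply: leq_bigmax|exists q].
  have [q qP] := choice _ hq.
  exists k', (fun i => pi (a ^+ k' *: p i - q i)); split=> [i|].
    exact/lcJ/(qP i).2.
  (* The combination of the remainders lies in J and avoids its leading monomials, so it vanishes;
     subtracting the remainders then leaves the sum unchanged. *)
  have q0 : \sum_i c i *: q i = 0.
    apply: Joff; last by apply: off_sum => i _; apply/offZ/(qP i).1.
    have -> : \sum_i c i *: q i = a ^+ k' *: (\sum_i c i *: p i) -
        \sum_i c i *: (a ^+ k' *: p i - q i).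
      rewrite scaler_sumr -sumrB; apply: eq_bigr => i _.
      by rewrite scalerBr !scalerA [a ^+ k' * _]mulrC opprB addrC subrK.
    rewrite piB; apply: DD; first apply: (JZ).
      rewrite pi_sum; suff -> : \sum_i pi (c i *: p i) = \sum_i act (c i) (W i) by [].
      by apply: eq_bigr => i _; rewrite piZ hp.
    rewrite -[- pi _]add0r -pi0 -piB sub0r -scaleN1r; apply: (JZ).
    rewrite pi_sum; apply: (big_ind D) => // i _; apply: (JZ).
    exact/lcJ/(qP i).2.
  transitivity (pi (\sum_i c i *: (a ^+ k' *: p i))).
    by rewrite pi_sum; apply: eq_bigr => i _; rewrite hp !piZ.
  transitivity (pi (\sum_i c i *: (a ^+ k' *: p i) - \sum_i c i *: q i)).
    by rewrite q0 subr0.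
  rewrite -sumrB pi_sum; apply: eq_bigr => i _.
  by rewrite -scalerBr piZ.
have [k hk] := div p; have [q hq lq] := hk k (leqnn k); exists k.
suff q0 : q = 0 by rewrite q0 subr0 in lq; rewrite -piZ; apply: lcJ.
have : b *: q = 0.
  apply: Joff; last exact: offZ.
  have -> : b *: q = a ^+ k *: (b *: p) - b *: (a ^+ k *: p - q).
    by rewrite scalerBr !scalerA [a ^+ k * _]mulrC opprB addrC subrK.
  rewrite piB; apply: DD; first by apply: (JZ); rewrite piZ.
  rewrite -[- pi _]add0r -pi0 -piB sub0r -scaleN1r; apply: (JZ).
  exact/JZ/lcJ.
by move=> /eqP; rewrite mscalerI (negbTE b0) => /eqP.
Qed.
End GenericFlatness.

(** * Specialization of the generic coefficients *)

(** Hilbert's basis theorem: over a field the denominators a^k of the division are invertible. *)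
Lemma ideal_fin_gen (K : fieldType) n (I : {mpoly K[n]} -> Prop) : is_ideal I ->
  exists fs : seq {mpoly K[n]}, (forall f, f \in fs -> I f) /\ forall p, I p -> lincomb fs p.
Proof.
move=> [I0 ID IM]; have [a [gs [E [a0 gsI Ioff div]]]] := @generic_freeness K n I I0 ID IM.
exists gs; split=> // p Ip; have [k hk] := div p; have [q hq lq] := hk k (leqnn k).
have IZ c f : I f -> I (c *: f) by rewrite -mul_mpolyC; apply: IM.
have lI f : lincomb gs f -> I f.
  move=> [h ->]; apply: (big_ind I) => // i _; apply: IM.
  by apply/gsI/mem_nth.
have q0 : q = 0.
  apply: Ioff => //; have -> : q = a ^+ k *: p + -1 *: (a ^+ k *: p - q).
    by rewrite scaleN1r opprB addrC subrK.
  by apply: ID; apply: (IZ) => //; apply: lI.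
have -> : p = (a ^+ k)^-1 *: (a ^+ k *: p).
  by rewrite scalerA mulVf ?scale1r // expf_neq0.
by apply: lincombZ; rewrite q0 subr0 in lq.
Qed.

HB.lock Definition evT (K : fieldType) (n : nat) (C : 'M[K]_n) :
  {mpoly {mpoly K[n]}[n * n]} -> {mpoly K[n]} := meval (fun k => (mxvec C 0 k)%:MP).

Section Specialization.
Variables (K : fieldType) (n : nat) (C : 'M[K]_n).
Local Notation S := {mpoly K[n]}.
Local Notation A := {mpoly K[n * n]}.
Local Notation T := {mpoly S[n * n]}.
Local Notation xT := (@xT K n).
Local Notation zT := (@zT K n).
Local Notation iota_A := (@iota_A K n).
Local Notation ev := (evT C).
Local Notation cst := (map_mx (@mpolyC (n * n) S)).

Lemma evD f g : ev (f + g) = ev f + ev g. Proof. by rewrite unlock; apply: mevalD. Qed.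
Lemma evM f g : ev (f * g) = ev f * ev g. Proof. by rewrite unlock; apply: mevalM. Qed.
Lemma ev_cst s : ev s%:MP = s. Proof. by rewrite unlock; apply: mevalC. Qed.
Lemma ev_X i : ev 'X_i = (mxvec C 0 i)%:MP. Proof. by rewrite unlock; apply: mevalXU. Qed.

Lemma ev0 : ev 0 = 0.
Proof. by rewrite -(mpolyC0 (n * n)) ev_cst. Qed.

Lemma ev_sum (I : Type) (r : seq I) (Q : pred I) F :
  ev (\sum_(i <- r | Q i) F i) = \sum_(i <- r | Q i) ev (F i).
Proof. exact: (big_morph ev evD ev0). Qed.

Lemma ev_iota b : ev (iota_A b) = (b.@[fun k => mxvec C 0 k])%:MP.
Proof.
elim/mpolyX_ind: b => [k|i f IHf|f g IHf IHg].
- by rewrite iota_C ev_cst mevalC.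
- by rewrite iotaM evM IHf iota_X ev_X mevalM mevalXU mpolyCM.
- by rewrite iotaD evD IHf IHg mevalD mpolyCD.
Qed.

Lemma ev_z i : ev (zT i) = lin_forms C i.
Proof.
rewrite ev_sum; apply: eq_bigr => j _.
by rewrite evM ev_X ev_cst mxvecE mul_mpolyC.
Qed.

Definition evmx c (v : 'rV[T]_c) : 'rV[S]_c := map_mx ev v.

Lemma evmxD c (u v : 'rV[T]_c) : evmx (u + v) = evmx u + evmx v.
Proof. by apply/rowP => i; rewrite !mxE evD. Qed.

Lemma evmxZ c a (v : 'rV[T]_c) : evmx (a *: v) = ev a *: evmx v.
Proof. by apply/rowP => i; rewrite !mxE evM. Qed.

Lemma evmx0 c : evmx (0 : 'rV[T]_c) = 0.
Proof. by apply/rowP => i; rewrite !mxE ev0. Qed.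

Lemma evmx_sum c (I : Type) (r : seq I) (Q : pred I) (F : I -> 'rV[T]_c) :
  evmx (\sum_(i <- r | Q i) F i) = \sum_(i <- r | Q i) evmx (F i).
Proof. exact: (big_morph _ (@evmxD c) (@evmx0 c)). Qed.

Lemma evmx_cst c (v : 'rV[S]_c) : evmx (cst v) = v.
Proof. by apply/rowP => i; rewrite !mxE ev_cst. Qed.

Lemma evmx_ext c (N : 'rV[S]_c -> Prop) v : submod N -> ext N v -> N (evmx v).
Proof.
move=> [N0 ND NZ] hv; apply: (ext_ind (W := fun v => N (evmx v))) => [|m].
  split=> [|u w Nu Nw|a u Nu].
  - by rewrite evmx0.
  - by rewrite evmxD; apply: ND.
  - by rewrite evmxZ; apply: NZ.
by rewrite evmx_cst.
Qed.

Lemma evmx_zspan c (N : 'rV[S]_c -> Prop) i v : submod N ->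
  zspan zT i (ext N) v -> zspan (lin_forms C) i N (evmx v).
Proof.
move=> sN [w [Nw ->]]; exists (fun l => evmx (w l)); split=> [l|]; first exact: evmx_ext.
by rewrite evmx_sum; apply: eq_bigr => l _; rewrite evmxZ ev_z.
Qed.

(** These generate the maximal ideal of K[c] at the point C. *)
Definition dcT (i j : 'I_n) : A := 'X_(mxvec_index i j) - (C i j)%:MP.

Lemma dcT_eval i j : (dcT i j).@[fun k => mxvec C 0 k] = 0.
Proof. by rewrite mevalB mevalXU mevalC mxvecE subrr. Qed.

Lemma lin_formsT i : (lin_forms C i)%:MP = \sum_j ((C i j)%:MP : S)%:MP * xT j.
Proof. by rewrite raddf_sum; apply: eq_bigr => j _ /=; rewrite -mul_mpolyC mpolyCM. Qed.

Lemma zT_split i : \sum_j iota_A (dcT i j) * xT j = zT i - (lin_forms C i)%:MP.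
Proof.
rewrite lin_formsT -sumrB; apply: eq_bigr => j _ /=.
have -> : iota_A (dcT i j) = cT K i j - ((C i j)%:MP : S)%:MP.
  by apply/eqP; rewrite eq_sym subr_eq -iota_C -iotaD subrK iota_X.
by rewrite mulrBl.
Qed.

Lemma evmxN c (v : 'rV[T]_c) : evmx (- v) = - evmx v.
Proof. by apply: (addrI (evmx v)); rewrite -evmxD !subrr evmx0. Qed.
End Specialization.

(** * The Rees algebra as a quotient of a polynomial ring over K[c] *)

Section ReesPresentation.
Variables (K : fieldType) (n : nat) (I : {mpoly K[n]} -> Prop) (iI : is_ideal I).
Local Notation S := {mpoly K[n]}.
Local Notation A := {mpoly K[n * n]}.
Local Notation T := {mpoly S[n * n]}.
Local Notation xT := (@xT K n).
Local Notation zT := (@zT K n).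
Local Notation iota_A := (@iota_A K n).
Local Notation cst := (map_mx (@mpolyC (n * n) S)).
Local Notation extI k := (@ext S (n * n) 1 (ivec (pow_ideal I k))).
Variables (fs : seq S) (fsI : forall f, f \in fs -> I f) (fs_gen : forall p, I p -> lincomb fs p).
Local Notation N := (n + size fs)%N.
Local Notation P := {mpoly A[N]}.

(** The map from K[c][x, y] onto R(I)[c] sends x_j to x_j and y_s to f_s t, where the f_s generate
    I. *)
Definition rees_gen (i : 'I_N) : {poly T} :=
  match split i with inl j => (xT j)%:P | inr s => ((fs`_s)%:MP)%:P * 'X end.

Lemma rees_map_ex : exists pi : P -> {poly T}, [/\ forall a, pi a%:MP = (iota_A a)%:P,
  forall i, pi 'X_i = rees_gen i, forall f g, pi (f + g) = pi f + pi g &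
  forall f g, pi (f * g) = pi f * pi g].
Proof.
exists (mmap (polyC \o map_mpoly (@mpolyC n K)) rees_gen); split=> [a|i|f g|f g].
- by rewrite mmapC unlock.
- by rewrite mmapX mmap1U.
- exact: rmorphD.
- exact: rmorphM.
Qed.

Variable pi : P -> {poly T}.
Hypotheses (piC : forall a, pi a%:MP = (iota_A a)%:P) (piX : forall i, pi 'X_i = rees_gen i)
  (piD : forall f g, pi (f + g) = pi f + pi g) (piM : forall f g, pi (f * g) = pi f * pi g).

Lemma piZ c f : pi (c *: f) = iota_A c *: pi f.
Proof. by rewrite -mul_mpolyC piM piC mul_polyC. Qed.

Definition asm (F : nat -> 'rV[T]_1 -> Prop) (f : {poly T}) : Prop := forall k, F k (f`_k)%:M.

Definition tp k (v : 'rV[T]_1) : {poly T} := v 0 0 *: 'X^k.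

Lemma asm_tp (F : nat -> 'rV[T]_1 -> Prop) k v : (forall j, F j 0) -> F k v -> asm F (tp k v).
Proof.
move=> F0 Fv j; rewrite coefZ coefXn; case: eqP => [->|_]; last by rewrite mulr0 raddf0.
suff -> : (v 0 0 * true%:R)%:M = v by [].
by apply/matrixP => r s; rewrite !ord1 mxE mulr1 eqxx.
Qed.

Lemma coef_tp k v : ((tp k v)`_k)%:M = v.
Proof.
by rewrite coefZ coefXn eqxx mulr1; apply/matrixP => r s; rewrite !ord1 mxE eqxx.
Qed.

(** Stability is checked on generators: x_j and the elements of K[c] act inside each piece, and f_s
    t moves piece k into piece k + 1. *)
Lemma asm_closed (F : nat -> 'rV[T]_1 -> Prop) : (forall k, submod (F k)) ->
  (forall k f v, f \in fs -> F k v -> F k.+1 (f%:MP *: v)) ->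
  forall c f, asm F (pi f) -> asm F (pi (c * f)).
Proof.
move=> sF FM c; elim/mpolyX_ind: c => [a|i c IHc|c c' IHc IHc'] f Df.
- move=> k; rewrite piM piC coefCM -scale_scalar_mx.
  by have [_ _ hZ] := sF k; apply: hZ.
- rewrite -mulrA piM piX /rees_gen; case: (split i) => [j|s] k.
    rewrite coefCM -scale_scalar_mx.
    by have [_ _ hZ] := sF k; apply/hZ/IHc.
  rewrite -mulrA coefCM -scale_scalar_mx coefXM.
  case: k => [|k] /=; first by rewrite raddf0 scaler0; have [] := sF 0%N.
  by apply: FM; [apply/mem_nth/ltn_ord|apply: IHc].
- by move=> k; rewrite mulrDl piD coefD raddfD; have [_ hD _] := sF k; apply: hD; [apply: IHc|apply: IHc'].
Qed.

Definition im (f : {poly T}) : Prop := exists p, f = pi p.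

Lemma imD f g : im f -> im g -> im (f + g).
Proof. by move=> [p ->] [q ->]; exists (p + q); rewrite piD. Qed.

Lemma imM f g : im f -> im g -> im (f * g).
Proof. by move=> [p ->] [q ->]; exists (p * q); rewrite piM. Qed.

Lemma im_iota a : im (iota_A a)%:P. Proof. by exists a%:MP; rewrite piC. Qed.

Lemma im0 : im (0 : {poly T}).
Proof. by have := im_iota 0; rewrite iota0 polyC0. Qed.

Lemma im_sum (J : Type) (r : seq J) (Q : pred J) (F : J -> {poly T}) :
  (forall j, Q j -> im (F j)) -> im (\sum_(j <- r | Q j) F j).
Proof. by move=> hF; apply: (big_ind im) => //; [exact: im0|exact: imD]. Qed.

Lemma im_const (c : T) : im c%:P.
Proof.
elim/T_ind: c => [k|j f IHf|i f IHf|f g IHf IHg].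
- by rewrite -iota_C; apply: im_iota.
- rewrite polyCM; apply: imM; last exact: IHf.
  exists 'X_(lshift (size fs) j).
  by rewrite piX /rees_gen (unsplitK (inl j)).
- by rewrite polyCM -iota_X; apply: imM IHf; apply: im_iota.
- by rewrite polyCD; apply: imD IHf IHg.
Qed.

Lemma im_scale c f : im f -> im (c *: f).
Proof. by move=> hf; rewrite -mul_polyC; apply: imM hf; apply: im_const. Qed.

Lemma im_gen (s : 'I_(size fs)) : im (((fs`_s)%:MP)%:P * 'X).
Proof. by exists 'X_(rshift n s); rewrite piX /rees_gen (unsplitK (inr s)). Qed.

Lemma im_ideal (p : S) : I p -> im ((p%:MP : T)%:P * 'X).
Proof.
move=> /fs_gen[h ->]; rewrite raddf_sum /= raddf_sum /= mulr_suml.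
apply: im_sum => s _; rewrite mpolyCM polyCM -mulrA.
by apply: imM; [apply: im_const|apply: im_gen].
Qed.

Lemma im_pow k (p : S) : pow_ideal I k p -> im ((p%:MP : T) *: 'X^k).
Proof.
elim: k p => [|k IHk] p; first by move=> _; rewrite expr0 -mul_polyC mulr1; apply: im_const.
move=> hp; apply: (@gen_ideal_min _ _ _ (fun p => im ((p%:MP : T) *: 'X^(k.+1))) p _ _ hp); first split.
- by rewrite mpolyC0 scale0r; apply: im0.
- by move=> q q' hq hq'; rewrite mpolyCD scalerDl; apply: imD.
- by move=> c q hq; rewrite mpolyCM -scalerA; apply: im_scale.
move=> _ [a [b [ha hb ->]]].
have -> : ((a * b)%:MP : T) *: 'X^(k.+1) = ((a%:MP : T) *: 'X^k) * ((b%:MP : T)%:P * 'X).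
  by rewrite mpolyCM exprSr -!mul_polyC polyCM !mulrA; congr (_ * _); rewrite -!mulrA [_ * 'X^k]mulrC.
by apply: imM; [apply: IHk|apply: im_ideal].
Qed.

(** Surjectivity onto R(I)[c], so that [generic_flatness] applies to all of its elements. *)
Lemma im_asm f : asm (fun k => extI k) f -> im f.
Proof.
move=> hf; have -> : f = \sum_(k < size f) tp k (f`_k)%:M.
  rewrite -{1}[f]coefK poly_def; apply: eq_bigr => k _.
  by rewrite /tp mxE eqxx.
apply: im_sum => k _; apply: (ext_ind (W := fun v => im (tp k v))) => [|m].
  split=> [|u v hu hv|a u hu].
  - by rewrite /tp mxE scale0r; apply: im0.
  - by rewrite /tp mxE scalerDl; apply: imD.
  - by rewrite /tp mxE -scalerA; apply: im_scale.
rewrite /tp mxE; apply: im_pow; exact: hf.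
Qed.

Lemma extI_mul k f v : f \in fs -> extI k v -> extI k.+1 (f%:MP *: v).
Proof.
move=> /fsI If hv m; rewrite /ivec !mxE mcoeffCM mulrC.
apply: gen_ideal_gen; exists ((v 0 0)@_m), f; split=> //.
by have := hv m; rewrite /ivec mxE.
Qed.

Lemma extI_submod k : submod (extI k).
Proof. by apply/ext_submod/ivec_submod/pow_ideal_is_ideal. Qed.

Definition zmT (i : 'I_n) k : 'rV[T]_1 -> Prop :=
  padd (zspan zT i (extI k)) (mulby (zT i) (zspan xT n (extI k))).

Lemma zmT_submod i k : submod (zmT i k).
Proof.
have sE := extI_submod k.
by apply: padd_submod; [apply: zspan_submod|apply/mulby_submod/zspan_submod].
Qed.

(* The flatness of R(I)[c] / (z_<i) and R(I)[c] / ((z_<i) + z_i m), after inverting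
   one polynomial in the coefficients c. *)
Lemma rees_generic_flatness (i : 'I_n) : exists a1 a2 : A, [/\ a1 != 0, a2 != 0,
  forall k v b, extI k v -> b != 0 -> zspan zT i (extI k) (iota_A b *: v) ->
    exists l, zspan zT i (extI k) (iota_A (a1 ^+ l) *: v) &
  forall k (J : finType) (W : J -> 'rV[T]_1) (c : J -> A), (forall j, extI k (W j)) ->
    zmT i k (\sum_j iota_A (c j) *: W j) ->
    exists l (W' : J -> 'rV[T]_1), (forall j, zmT i k (W' j)) /\
      \sum_j iota_A (c j) *: (iota_A (a2 ^+ l) *: W j) = \sum_j iota_A (c j) *: W' j].
Proof.
pose act (b : A) (f : {poly T}) := iota_A b *: f.
have tpZ k c v : tp k (c *: v) = c *: tp k v by rewrite /tp mxE scalerA.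
have tpD k u v : tp k (u + v) = tp k u + tp k v by rewrite /tp mxE scalerDl.
have tp0 k : tp k 0 = 0 by rewrite /tp mxE scale0r.
have tp_sum k (J : finType) (F : J -> 'rV[T]_1) : \sum_j tp k (F j) = tp k (\sum_j F j).
  by rewrite (big_morph (tp k) (tpD k) (tp0 k)).
have asmD F : (forall k, submod (F k)) -> forall u v, asm F u -> asm F v -> asm F (u + v).
  move=> sF u v hu hv k; rewrite coefD raddfD; have [_ hD _] := sF k; exact: hD.
have asm0 F : (forall k, submod (F k)) -> asm F 0.
  by move=> sF k; rewrite coef0 raddf0; have [] := sF k.
have im_tp k v : extI k v -> im (tp k v).
  move=> hv; apply: im_asm; apply: asm_tp hv => j; by have [] := extI_submod j.
have F1s k : submod (zspan zT i (extI k)) by apply/zspan_submod/extI_submod.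
have F1M k f v : f \in fs -> zspan zT i (extI k) v -> zspan zT i (extI k.+1) (f%:MP *: v).
  by move=> ff; apply: zspan_scale => u; apply: extI_mul.
have F2M k f v : f \in fs -> zmT i k v -> zmT i k.+1 (f%:MP *: v).
  move=> ff; apply: padd_scale => u; first exact: F1M.
  by apply: mulby_scale => w; apply: zspan_scale => y; apply: extI_mul.
have F2s := zmT_submod i.
have [a1 [a10 _ h1]] := @generic_flatness A N {poly T} pi act _ piD piZ (asm0 _ F1s) (asmD _ F1s)
  (asm_closed F1s F1M).
have [a2 [a20 h2 _]] := @generic_flatness A N {poly T} pi act _ piD piZ (asm0 _ F2s) (asmD _ F2s)
  (asm_closed F2s F2M).
have coef_sumM (J : finType) (F : J -> {poly T}) k :
    ((\sum_j F j)`_k)%:M = \sum_j ((F j)`_k)%:M :> 'rV[T]_1.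
  by rewrite coef_sum raddf_sum.
have coefZM b (f : {poly T}) k : ((b *: f)`_k)%:M = b *: (f`_k)%:M :> 'rV[T]_1.
  by rewrite coefZ scale_scalar_mx.
exists a1, a2; split=> // [k v b hv b0 hb|k J W c hW hD].
  have [||l hl] := h1 (tp k v) b _ b0.
  - exact: im_tp.
  - by rewrite /act -tpZ; apply: asm_tp => // j; have [] := F1s j.
  by exists l; have := hl k; rewrite coefZM coef_tp.
have [j||l [W' [hW' WE]]] := h2 J (fun j => tp k (W j)) c.
- exact/im_tp/hW.
- suff -> : \sum_j act (c j) (tp k (W j)) = tp k (\sum_j iota_A (c j) *: W j).
    by apply: asm_tp => // j; have [] := F2s j.
  by rewrite -tp_sum; apply: eq_bigr => j _; rewrite tpZ.
exists l, (fun j => ((W' j)`_k)%:M); split=> [j|]; first exact: hW'.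
have := congr1 (fun f : {poly T} => ((f`_k)%:M : 'rV[T]_1)) WE.
rewrite !coef_sumM => WE'.
transitivity (\sum_j ((act (c j) (act (a2 ^+ l) (tp k (W j))))`_k)%:M : 'rV[T]_1).
  by apply: eq_bigr => j _; rewrite 2!coefZM coef_tp.
by rewrite WE'; apply: eq_bigr => j _; rewrite coefZM.
Qed.
End ReesPresentation.

(** * Descent from the generic forms to a specialization *)

Section SecondHalf.
Variables (K : fieldType) (n : nat) (I : {mpoly K[n]} -> Prop) (gI : graded_ideal I).
Hypothesis cI : forall k, (1 <= k)%N -> componentwise_linear (pow_ideal I k).
Local Notation S := {mpoly K[n]}.
Local Notation A := {mpoly K[n * n]}.
Local Notation T := {mpoly S[n * n]}.
Local Notation xT := (@xT K n).
Local Notation zT := (@zT K n).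
Local Notation nzT := (@nzT K n).
Local Notation iota_A := (@iota_A K n).
Local Notation cst := (map_mx (@mpolyC (n * n) S)).
Local Notation N k := (ivec (pow_ideal I k)).
Local Notation extI k := (@ext S (n * n) 1 (N k)).

Lemma generic_dseq_pow k (i : 'I_n) (u : 'rV[T]_1) :
  zspan xT n (extI k) u -> zspan zT i (extI k) (zT i *: u) -> sat nzT (zspan zT i (extI k)) u.
Proof.
case: k => [|k] mu zu.
  (* [cI] says nothing about I^0 = S; there z_i is regular modulo (z_<i) up to K[c]. *)
  apply: (@sat_sub _ _ _ (zspan zT i (fun _ => True))) => [v|].
    by apply: zspan_sub => w _ m.
  by apply: zT_reg1; apply: zspan_sub zu.
exact: (generic_dseq_componentwise_linear (pow_ideal_graded k.+1 gI) (@cI k.+1 isT) mu zu).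
Qed.

Lemma zspan_xT_cst k (C : 'M[K]_n) (u : 'rV[S]_1) : zspan (lin_forms C) n (N k) u ->
  zspan xT n (extI k) (cst u).
Proof.
have sN := ivec_submod (pow_ideal_is_ideal k gI.1); have sE := @ext_submod _ (n * n) _ _ sN.
have sM := zspan_submod xT n sE; have [_ _ hZ] := sM.
move=> [w [Nw ->]].
rewrite cst_sum; apply: submod_sum => // l _.
rewrite cstZ lin_formsT scaler_suml.
apply: submod_sum => // j _; rewrite -scalerA; apply: (hZ); apply: zspan_gen => //; exact: ext_cst.
Qed.

Lemma specialize_dseq (C : 'M[K]_n) (i : 'I_n) (a1 a2 : A) :
  (forall k v b, extI k v -> b != 0 -> zspan zT i (extI k) (iota_A b *: v) ->
    exists l, zspan zT i (extI k) (iota_A (a1 ^+ l) *: v)) ->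
  (forall k (J : finType) (W : J -> 'rV[T]_1) (c : J -> A), (forall j, extI k (W j)) ->
    zmT I i k (\sum_j iota_A (c j) *: W j) ->
    exists l (W' : J -> 'rV[T]_1), (forall j, zmT I i k (W' j)) /\
      \sum_j iota_A (c j) *: (iota_A (a2 ^+ l) *: W j) = \sum_j iota_A (c j) *: W' j) ->
  a1.@[fun k => mxvec C 0 k] != 0 -> a2.@[fun k => mxvec C 0 k] != 0 ->
  forall k u, zspan (lin_forms C) n (N k) u -> zspan (lin_forms C) i (N k) (lin_forms C i *: u) ->
    zspan (lin_forms C) i (N k) u.
Proof.
move=> h1 h2 a1C a2C k u mu [w [Nw zuE]].
have sN := ivec_submod (pow_ideal_is_ideal k gI.1); have sE := @ext_submod _ (n * n) _ _ sN.
have sM := zspan_submod zT i sE; have sX := zspan_submod xT n sE.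
have mcu := zspan_xT_cst mu; have Nu := zspan_in sN mu.
pose W (lj : 'I_n * 'I_n) : 'rV[T]_1 := xT lj.2 *:
  (if lj.1 == i then cst u else if (lj.1 < i)%N then - cst (w lj.1) else 0).
pose c (lj : 'I_n * 'I_n) : A := dcT C lj.1 lj.2.
pose Y := zT i *: cst u - \sum_(l < n | (l < i)%N) zT l *: cst (w l).
(* The relation holds at C, so over K[c] only the differences c_lj - C_lj contribute. *)
have YE : \sum_lj iota_A (c lj) *: W lj = Y.
  have WE lj : iota_A (c lj) *: W lj = (iota_A (dcT C lj.1 lj.2) * xT lj.2) *:
      (if lj.1 == i then cst u else if (lj.1 < i)%N then - cst (w lj.1) else 0).
    by rewrite scalerA.
  rewrite (eq_bigr _ (fun lj _ => WE lj)).
  rewrite (@sum_pivot_sub T 'rV[T]_1 n (fun l j => iota_A (dcT C l j) * xT j) zT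
    (fun l => (lin_forms C l)%:MP) i (cst u) (fun l => cst (w l)) (zT_split C)).
  rewrite -[RHS]subr0; congr (_ - _).
  rewrite -cstZ zuE cst_sum; apply/eqP; rewrite subr_eq0; apply/eqP.
  by apply: eq_bigr => l _; rewrite cstZ.
have [lj||l [W' [hW' WE]]] := h2 k _ W c.
- have [E0 _ hZ] := sE; apply: hZ; case: ifP => _; first exact: ext_cst.
  by case: ifP => _ //; apply: (submod_opp sE); apply: ext_cst.
(* u lies in m I^k, so Y lies in (z_<i) I^k + z_i m I^k after extension to S[c]. *)
- rewrite YE; exists (- \sum_(l < n | (l < i)%N) zT l *: cst (w l)), (zT i *: cst u).
  split; last by rewrite addrC.
    apply: (submod_opp sM); exists (fun l => cst (w l)); split=> [l|]; [exact: ext_cst|reflexivity].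
  by exists (cst u).
have hW'' lj : exists vm : 'rV[T]_1 * 'rV[T]_1,
    [/\ zspan zT i (extI k) vm.1, zspan xT n (extI k) vm.2 & W' lj = vm.1 + zT i *: vm.2].
  have [v [_ [hv [m hm ->] ->]]] := hW' lj; exists (v, m).
  by split; [exact: hv|exact: hm|reflexivity].
have [vm hvm] := choice _ hW''.
(* The correction takes away the z_i m parts of the W', which puts z_i [V0] in (z_<i) I^k; its
   coefficients c_lj - C_lj vanish at C. *)
pose V0 := iota_A (a2 ^+ l) *: cst u - \sum_lj iota_A (c lj) *: (vm lj).2.
have mV0 : zspan xT n (extI k) V0.
  have [_ _ hZ] := sX; apply: (submod_sub sX); first exact: hZ.
  by apply: submod_sum => // lj _; apply: hZ; have [] := hvm lj.
have zV0 : zspan zT i (extI k) (zT i *: V0).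
  have -> : zT i *: V0 = iota_A (a2 ^+ l) *: (\sum_(l < n | (l < i)%N) zT l *: cst (w l)) +
      \sum_lj iota_A (c lj) *: (vm lj).1.
    apply: scaled_relation.
    transitivity (\sum_lj iota_A (c lj) *: (iota_A (a2 ^+ l) *: W lj)).
      transitivity (iota_A (a2 ^+ l) *: Y); first reflexivity.
      rewrite -YE scaler_sumr; apply: eq_bigr => lj _; exact: scaler_swap.
    apply: (etrans WE); apply: eq_bigr => lj _.
    have [_ _ W'E] := hvm lj; exact: (congr1 _ W'E).
  have [_ hD hZ] := sM; apply: hD.
    by apply: hZ; exists (fun l => cst (w l)); split=> [l'|]; [exact: ext_cst|reflexivity].
  apply: submod_sum => [|lj _]; first exact: sM.
  by apply: hZ; have [hv _ _] := hvm lj; exact: hv.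
have [_ [b b0 ->] hb] := generic_dseq_pow mV0 zV0.
(* b may vanish at C, whereas a power of a1 does not. *)
have [l1 hl1] := h1 k V0 b (zspan_in sE mV0) b0 hb.
have := evmx_zspan C sN hl1; rewrite evmxZ ev_iota evmxD evmxZ ev_iota evmx_cst.
have -> : evmx C (- \sum_lj iota_A (c lj) *: (vm lj).2) = 0.
  rewrite evmxN evmx_sum big1 ?oppr0 // => lj _.
  by rewrite evmxZ ev_iota dcT_eval mpolyC0 scale0r.
rewrite addr0 scalerA -mpolyCM.
set q := (_ * _ : K); have q0 : q != 0.
  by rewrite mulf_neq0 // rmorphXn expf_neq0.
have sz := zspan_submod (lin_forms C) i sN.
move=> hq; have -> : u = (q^-1)%:MP *: (q%:MP *: u).
  by rewrite scalerA -mpolyCM mulVf // mpolyC1 scale1r.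
by have [_ _ hZ] := sz; apply: hZ.
Qed.
End SecondHalf.

Theorem theorem1p4 (K : fieldType) (n : nat) (I : {mpoly K[n]} -> Prop) :
  infinite_type K -> graded_ideal I ->
  ((exists C : 'M[K]_n, C \in unitmx /\ d_sequence (lin_forms C) (rees I)) ->
     forall k, (1 <= k)%N -> componentwise_linear (pow_ideal I k))
  /\
  ((forall k, (1 <= k)%N -> componentwise_linear (pow_ideal I k)) ->
     generic_basis (fun z => d_sequence z (rees I))).
Proof.
move=> K_inf gI; split=> [[C [C_unit dC]] k _|cI].
  exact: d_sequence_componentwise_linear dC.
have [fs [fsI fs_gen]] := ideal_fin_gen gI.1.
have [pi [piC piX piD piM]] := rees_map_ex fs.
have [a1 ha1] := choice _ (rees_generic_flatness gI.1 fsI fs_gen piC piX piD piM).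
have [a2 ha] := choice _ ha1.
(* [a1 i] and [a2 i] do not depend on k, so this one polynomial serves all powers of I. *)
pose f := \prod_i (a1 i * a2 i).
exists (fun C => f.@[fun k => mxvec C 0 k] != 0); split.
- by exists [:: f] => C; rewrite /= orbF.
- have f0 : f != 0 by apply/prodf_neq0 => i _; have [a10 a20 _ _] := ha i; rewrite mulf_neq0.
  have [v hv] := mpoly_nonroot K_inf f0; exists (vec_mx (\row_k v k)).
  by rewrite (meval_eq (v2 := v)) // => k; rewrite vec_mxK mxE.
move=> C fC _; apply/(d_sequence_rees gI.1) => k i u.
have [a10 a20 h1 h2] := ha i.
move: fC; rewrite /f rmorph_prod /= => /prodf_neq0/(_ i isT).
rewrite mevalM mulf_eq0 negb_or => /andP[a1C a2C].
exact: (specialize_dseq gI cI h1 h2 a1C a2C).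
Qed.
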